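(* Consider a splitting method (as defined in the context) whose kernel $K$ is $V$-uniformly ergodic for some function $V$, and assume $\mu_0\{V<\infty\}=1$. Then the following three conditions are equivalent: (i) For every $\epsilon>0$, $\mathbb P\left\{\left|\frac1T\sum_{t=0}^{T-1}\sum_{i=1}^{N_t}w_t^i-1\right|>\epsilon\right\}\to 0$ as $T\to\infty$. (ii) With probability one, $\sum_{i=1}^{N_t}w_t^i=1$ for all $t\ge 0$. (iii) For every measurable $f:X\to\mathbb R$ with $\sup_x f(x)^2/V(x)<\infty$, $$\mathbb P\left\{\frac1T\sum_{t=0}^{T-1}\sum_{i=1}^{N_t}w_t^i f(\xi_t^i)\xrightarrow{T\to\infty}\mu(f)\right\}=1.$$
   Context: Splitting method: Let $K$ be a Markov transition kernel on a measurable state space $X$ and $\mu_0$ a probability distribution on $X$. A splitting method produces, for $t=0,1,2,\dots$, particles $\xi_t^1,\dots,\xi_t^{N_t}\in X$ with weights $w_t^1,\dots,w_t^{N_t}\ge 0$, together with a filtration $\mathcal F_0\subseteq\hat{\mathcal F}_0\subseteq\mathcal F_1\subseteq\hat{\mathcal F}_1\subseteq\cdots$, as follows. Initially $\xi_0^1,\dots,\xi_0^{N_0}$ are i.i.d. with law $\mu_0$ and $w_0^i=1/N_0$. At each time $t\ge 0$: (Splitting step) for each $i$ a number $C_t^i>0$ is chosen, where $(\xi_t^i,w_t^i,C_t^i)_{1\le i\le N_t}$ is $\mathcal F_t$-measurable; random nonnegative integers $N_t^i$ are drawn with $\mathbb E[N_t^i\mid\mathcal F_t]=C_t^i$; each $\xi_t^i$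 is replaced by $N_t^i$ copies, each with weight $w_t^i/C_t^i$; the resulting children are listed as $(\hat\xi_t^j,\hat w_t^j)_{1\le j\le N_{t+1}}$ with $N_{t+1}=\sum_i N_t^i$, and they are $\hat{\mathcal F}_t$-measurable. (Evolution step) conditional on $\hat{\mathcal F}_t$, the particles $\xi_{t+1}^1,\dots,\xi_{t+1}^{N_{t+1}}$ are independent with $\xi_{t+1}^j\sim K(\hat\xi_t^j,\cdot)$, and $w_{t+1}^j=\hat w_t^j$. $V$-uniform ergodicity: $K$ is $\psi$-irreducible and aperiodic with invariant probability $\mu=\mu K$; for a measurable $V:X\to[1,\infty]$ with $\mu(V)<\infty$, $K$ is $V$-uniformly ergodic if there exist $R>0$, $\rho<1$ with $\sup_{|g|\le V}|K^tg(x)-\mu(g)|\le R\rho^tV(x)$ for all $x\in X$, $t\ge0$. Here $\mu(g)=\int g\,d\mu$. *)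

(* Defs.v *)
From HB Require Import structures.
From mathcomp Require Import all_boot all_order all_algebra.
From mathcomp Require Import all_classical all_reals all_analysis.
From mathcomp Require Import measurable_realfun.
Set Implicit Arguments. Unset Strict Implicit. Unset Printing Implicit Defensive.
Import Order.TTheory GRing.Theory Num.Theory.
Import numFieldNormedType.Exports.
Local Open Scope classical_set_scope.
Local Open Scope ring_scope.

Section Defs.
Context {R : realType}.

Definition sub_sigma {d} {T : measurableType d} (G : set (set T)) :=
  sigma_algebra setT G /\ G `<=` measurable.

Definition Gmeasurable {d} {T : measurableType d} {dY} {Y : measurableType dY}
  (G : set (set T)) (D : set T) (f : T -> Y) :=
  G D /\ forall B, measurable B -> G (D `&` f @^-1` B).

Definition Gmeasurable_nat {d} {T : measurableType d}
  (G : set (set T)) (n : T -> nat) := forall k, G [set w | n w = k].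

(* K^t h for nonnegative h (Tonelli: equals int h dK^t(x,.)) *)
Fixpoint kpow_pos {dX} {X : measurableType dX} (K : R.-pker X ~> X)
  (t : nat) (h : X -> \bar R) : X -> \bar R :=
  match t with
  | 0 => h
  | t'.+1 => fun x => (\int[K x]_y kpow_pos K t' h y)%E
  end.

Definition kpow {dX} {X : measurableType dX} (K : R.-pker X ~> X)
  (t : nat) (g : X -> R) (x : X) : \bar R :=
  (kpow_pos K t (fun y => (Num.max (g y) 0)%:E) x
   - kpow_pos K t (fun y => (Num.max (- g y) 0)%:E) x)%E.

Definition kpow_set {dX} {X : measurableType dX} (K : R.-pker X ~> X)
  (t : nat) (A : set X) (x : X) : \bar R :=
  kpow_pos K t (fun y => (\1_A y)%:E) x.

Definition psi_irreducible {dX} {X : measurableType dX} (K : R.-pker X ~> X)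
  (psi : {measure set X -> \bar R}) :=
  (0 < psi setT)%E /\
  forall A, measurable A -> (0 < psi A)%E ->
    forall x, exists n, (0 < n)%N /\ (0 < kpow_set K n A x)%E.

Definition aperiodic {dX} {X : measurableType dX} (K : R.-pker X ~> X)
  (psi : {measure set X -> \bar R}) :=
  ~ exists (d : nat) (D : nat -> set X),
      [/\ (2 <= d)%N,
          (forall i, (i < d)%N -> measurable (D i)),
          (forall i j, (i < d)%N -> (j < d)%N -> i <> j -> D i `&` D j = set0),
          psi (~` \bigcup_(i in [set i | (i < d)%N]) D i) = 0%E &
          forall i x, (i < d)%N -> D i x -> K x (D ((i.+1) %% d)%N) = 1%E].

Definition invariant {dX} {X : measurableType dX} (K : R.-pker X ~> X)
  (mu : probability X R) :=
  forall A, measurable A -> mu A = (\int[mu]_x K x A)%E.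

Definition V_uniformly_ergodic {dX} {X : measurableType dX}
  (K : R.-pker X ~> X) (mu : probability X R) (V : X -> \bar R) :=
  [/\ exists psi, psi_irreducible K psi /\ aperiodic K psi,
      invariant K mu,
      measurable_fun [set: X] (V : X -> \bar R) /\ (forall x, 1%:E <= V x)%E,
      (\int[mu]_x V x < +oo)%E &
      exists (Rc rho : R), [/\ 0 < Rc, 0 < rho, rho < 1 &
        forall (g : X -> R), measurable_fun setT g ->
          (forall x, ((`|g x|)%:E <= V x)%E) ->
          forall x t,
            (`| kpow K t g x - \int[mu]_y (g y)%:E | <= (Rc * rho ^+ t)%:E * V x)%E]].

(** ** Splitting method
  [N t w] = N_t, [xi t i], [w t i], [C t i] = xi_t^i, w_t^i, C_t^i (0-based
  indices i < N_t), [M t i] = N_t^i, [xih t j], [wh t j] = hat xi_t^j,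
  hat w_t^j (j < N_{t+1}), [F t], [Fh t] = F_t, hat F_t. *)
Definition splitting_method
  {dO} {Om : measurableType dO} (P : probability Om R)
  {dX} {X : measurableType dX} (K : R.-pker X ~> X) (mu0 : probability X R)
  (N0 : nat) (N : nat -> Om -> nat)
  (xi : nat -> nat -> Om -> X) (w : nat -> nat -> Om -> R)
  (C : nat -> nat -> Om -> R) (M : nat -> nat -> Om -> nat)
  (xih : nat -> nat -> Om -> X) (wh : nat -> nat -> Om -> R)
  (F Fh : nat -> set (set Om)) :=
  [/\
   (forall t, [/\ sub_sigma (F t), sub_sigma (Fh t),
                  F t `<=` Fh t & Fh t `<=` F t.+1]),
   [/\ (0 < N0)%N, (forall om, N 0 om = N0),
       (forall i om, (i < N0)%N -> w 0 i om = (N0%:R)^-1) &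
       forall B : nat -> set X, (forall i, measurable (B i)) ->
         P [set om | forall i, (i < N0)%N -> B i (xi 0 i om)]
         = (\prod_(i < N0) fine (mu0 (B i)))%:E],
   (forall t,
     [/\ Gmeasurable_nat (F t) (N t),
         (forall i, [/\ Gmeasurable (F t) [set om | (i < N t om)%N] (xi t i),
                       Gmeasurable (F t) [set om | (i < N t om)%N] (w t i) &
                       Gmeasurable (F t) [set om | (i < N t om)%N] (C t i)]),
         (forall i om, (i < N t om)%N -> 0 < C t i om),
         (* N_t^i is a random variable with E[N_t^i | F_t] = C_t^i *)
         (forall i k, measurable ([set om | (i < N t om)%N] `&` [set om | M t i om = k])) /\
         (forall i A, F t A ->
            (\int[P]_(om in A `&` [set om | (i < N t om)%N]) ((M t i om)%:R)%:E
             = \int[P]_(om in A `&` [set om | (i < N t om)%N]) (C t i om)%:E)%E) &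
         (* children: N_t^i copies of xi_t^i with weight w_t^i / C_t^i *)
         [/\ (forall om, N t.+1 om = (\sum_(i < N t om) M t i om)%N),
             (forall om, exists par : nat -> nat,
                (forall j, (j < N t.+1 om)%N ->
                   [/\ (par j < N t om)%N, xih t j om = xi t (par j) om &
                       wh t j om = w t (par j) om / C t (par j) om]) /\
                (forall i, (i < N t om)%N ->
                   count (fun j => par j == i) (iota 0 (N t.+1 om)) = M t i om)),
             Gmeasurable_nat (Fh t) (N t.+1) &
             forall j, Gmeasurable (Fh t) [set om | (j < N t.+1 om)%N] (xih t j) /\
                       Gmeasurable (Fh t) [set om | (j < N t.+1 om)%N] (wh t j)]]) &
   (* evolution step: conditionally on Fh_t the xi_{t+1}^j are independent
      with laws K(xih_t^j, .) ; w_{t+1}^j = wh_t^j *)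
   (forall t,
     (forall j om, (j < N t.+1 om)%N -> w t.+1 j om = wh t j om) /\
     forall n A (B : nat -> set X), Fh t A -> (forall j, measurable (B j)) ->
       P (A `&` [set om | (n <= N t.+1 om)%N /\
                          forall j, (j < n)%N -> B j (xi t.+1 j om)])
       = (\int[P]_(om in A `&` [set om | (n <= N t.+1 om)%N])
            (\prod_(j < n) fine (K (xih t j om) (B j)))%:E)%E)].

End Defs.

(* Main.v *)
Require Import Defs.
From HB Require Import structures.
From mathcomp Require Import all_boot all_order all_algebra.
From mathcomp Require Import all_classical all_reals all_analysis.
From mathcomp Require Import measurable_realfun.
From mathcomp Require Import lra ring zify.
Import Order.TTheory GRing.Theory Num.Theory.
Import numFieldNormedType.Exports.
Local Open Scope classical_set_scope.
Local Open Scope ring_scope.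

(** The total mass is a nonnegative martingale started at 1.  If its Cesaro means
    tend to 1 in probability, then P(A) <= E[mass_t ; A] for A in F_t, because
    E[mass_t ; A] is the limit of the integrals over A of these means; with
    A = {mass_t < 1} and its complement this forces mass_t = 1 almost surely.

    Conversely, let all masses be 1, let f >= 0 with f^2 <= V, and write
    Y_t = sum_i w_t^i f(xi_t^i) and a = mu(f).  Only the conditional first moments
    E[m_{s+r}(h) | F_s] = m_s(K^r h) are needed (m_t is the weighted empirical
    measure): ergodicity in the weight sqrt V, obtained from the V-weighted one by
    truncation, bounds the covariance of Y_s and Y_{s+r} by O(rho^{r/2}) on the events
    {m_0(V) < L}, so that sum_{t<n} Y_t - a n has second moment O(n) there.  This gives
    almost sure convergence of the means along the squares, and the monotonicity of
    the sums fills the gaps.  Localizing in L is needed since mu_0(V) may be infinite.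
    A general f is a multiple of the difference of two such functions. *)

(** * Positive operators on nonnegative measurable functions *)

Section KernelOperators.
Local Open Scope ereal_scope.
Context {R : realType}.

(** The offspring numbers are known only through their conditional means: neither their variances
    nor their mutual dependence is controlled, so conditional variances of m_t(f) are out of reach.
    With all masses equal to 1 each m_s is a probability measure, and squares are controlled
    pathwise instead: m_s(f) is at most 2 sqrt(m_s(V)), and likewise for the excess of m_s(K^r f)
    over a. Since V may be infinite and the number of particles is random, everything is set up for
    [0,+oo]-valued functions. Transition kernels, weighted point masses, particle sums and integrals
    over an event become operators of one type, and two of them agree once they agree on indicators.
    Conditional expectations occur only as equalities of integrals over the sets of a
    sigma-algebra. *)

Definition nnm {d} {T : measurableType d} (f : T -> \bar R) :=
  measurable_fun setT f /\ (forall x, 0 <= f x).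

(** A transition kernel, given by its action on nonnegative functions: for each [u], [f |-> Phi f u]
    is integration against a measure. Compositions and sums of kernels then require no construction
    of measures. *)
Definition kern_op {d e} {T : measurableType d} {U : measurableType e}
    (Phi : (T -> \bar R) -> (U -> \bar R)) :=
  [/\ forall f, nnm f -> nnm (Phi f),
      forall f g, nnm f -> nnm g -> (forall x, f x <= g x) ->
        forall u, Phi f u <= Phi g u,
      forall f g, nnm f -> nnm g ->
        forall u, Phi (fun x => f x + g x) u = Phi f u + Phi g u,
      forall (k : R) f, (0 <= k)%R -> nnm f ->
        forall u, Phi (fun x => k%:E * f x) u = k%:E * Phi f u &
      forall f_ : nat -> T -> \bar R, (forall n, nnm (f_ n)) ->
        (forall x, {homo f_ ^~ x : n m / (n <= m)%N >-> n <= m}) ->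
        forall u, Phi (fun x => limn (f_ ^~ x)) u = limn (fun n => Phi (f_ n) u)].

Lemma nnm_indic {d} {T : measurableType d} (A : set T) :
  measurable A -> nnm (fun x => (\1_A x)%:E : \bar R).
Proof.
by move=> mA; split=> [|x]; [exact/measurable_EFinP/measurable_indic|rewrite lee_fin].
Qed.

Lemma nnm_cst {d} {T : measurableType d} (c : \bar R) :
  0 <= c -> nnm (fun _ : T => c).
Proof. by move=> c0; split => //; exact: measurable_cst. Qed.

Lemma nnmD {d} {T : measurableType d} (f g : T -> \bar R) :
  nnm f -> nnm g -> nnm (fun x => f x + g x).
Proof.
by move=> [mf f0] [mg g0]; split=> [|x]; [exact: emeasurable_funD|exact: adde_ge0].
Qed.

Lemma nnmM {d} {T : measurableType d} (f g : T -> \bar R) :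
  nnm f -> nnm g -> nnm (fun x => f x * g x).
Proof.
by move=> [mf f0] [mg g0]; split=> [|x]; [exact: emeasurable_funM|exact: mule_ge0].
Qed.

Lemma nnm_sum {d} {T : measurableType d} (f : nat -> T -> \bar R) n :
  (forall i, nnm (f i)) -> nnm (fun x => \sum_(i < n) f i x).
Proof.
move=> nf; elim: n => [|n IH].
  by under eq_fun do rewrite big_ord0; exact: nnm_cst.
by under eq_fun do rewrite big_ord_recr; exact: nnmD.
Qed.

Lemma nnm_lim {d} {T : measurableType d} (f_ : nat -> T -> \bar R) :
  (forall n, nnm (f_ n)) ->
  (forall x, {homo f_ ^~ x : n m / (n <= m)%N >-> n <= m}) ->
  nnm (fun x => limn (f_ ^~ x)).
Proof.
move=> nf ndf.
have cf x : f_ n x @[n --> \oo] --> limn (f_ ^~ x).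
  exact: (ereal_nondecreasing_is_cvgn (ndf x)).
split=> [|x].
  by apply: (emeasurable_fun_cvg f_) => [n|x _]; [exact: (nf n).1|exact: cf].
by apply: (cvge_to_ge (cf x)); near=> n; exact: (nf n).2.
Unshelve. all: end_near. Qed.

Import HBNNSimple.

(** A simple function is the sum over its range of a value times the indicator of its level set, and
    every nonnegative measurable function is a nondecreasing limit of simple ones. *)
Lemma nnm_ind {d} {T : measurableType d} (Q : (T -> \bar R) -> Prop) :
  (forall A, measurable A -> Q (fun x => (\1_A x)%:E)) ->
  (forall f g, nnm f -> nnm g -> Q f -> Q g -> Q (fun x => f x + g x)) ->
  (forall (k : R) f, (0 <= k)%R -> nnm f -> Q f -> Q (fun x => k%:E * f x)) ->
  (forall f_ : nat -> T -> \bar R, (forall n, nnm (f_ n)) ->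
     (forall x, {homo f_ ^~ x : n m / (n <= m)%N >-> n <= m}) ->
     (forall n, Q (f_ n)) -> Q (fun x => limn (f_ ^~ x))) ->
  forall f, nnm f -> Q f.
Proof.
move=> QI QD QZ QL f [mf f0].
have Q0 : Q (fun=> 0).
  have := QI set0 measurable0.
  by under eq_fun do rewrite indic0.
have QS (s : seq R) (h : {nnsfun T >-> R}) : {subset s <= [pred y | 0 <= y]%R} ->
    nnm (fun x => (\sum_(y <- s) y * \1_(h @^-1` [set y]) x)%:E) /\
    Q (fun x => (\sum_(y <- s) y * \1_(h @^-1` [set y]) x)%:E).
  elim: s => [_|y s IH sy].
    under eq_fun do rewrite big_nil.
    by split => //; exact: nnm_cst.
  have [|nI QI'] := IH; first by move=> z zs; apply: sy; rewrite in_cons zs orbT.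
  have y0 : (0 <= y)%R by apply: (sy y); rewrite in_cons eqxx.
  have nA := nnm_indic _ (measurable_sfunP h (measurable_set1 y)).
  under eq_fun do rewrite big_cons EFinD EFinM.
  have nYA : nnm (fun x => y%:E * (\1_(h @^-1` [set y]) x)%:E).
    by apply: nnmM nA; apply: nnm_cst; rewrite lee_fin.
  split; first exact: (nnmD _ _ nYA).
  apply: QD => //; apply: QZ => //; exact: QI.
have Qh (h : {nnsfun T >-> R}) : Q (fun x => (h x)%:E).
  under eq_fun do rewrite fimfunE fsbig_finite//=.
  apply: (QS _ h _).2 => y; rewrite in_fset_set// inE => -[x _ <-].
  exact: fun_ge0.
pose g n := nnsfun_approx measurableT mf n.
rewrite (_ : f = fun x => limn (fun n => (g n x)%:E)); last first.
  by apply/funext => x; apply/esym/cvg_lim => //; apply: cvg_nnsfun_approx.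
apply: (QL (fun n x => (g n x)%:E)) => [n|x n m nm|n]; last exact: Qh.
- split=> [|x]; first exact/measurable_EFinP.
  by rewrite lee_fin; exact: fun_ge0.
- by rewrite lee_fin; exact/lefP/nd_nnsfun_approx.
Qed.

(** Agreement on every measurable set, not just on generators, covers measures of infinite mass. The
    comparison at a single [u] lets an integral over a fixed event count as an operator with a dummy
    argument. *)
Lemma kern_op_ext {d e} {T : measurableType d} {U : measurableType e}
    (Phi Psi : (T -> \bar R) -> U -> \bar R) u :
  kern_op Phi -> kern_op Psi ->
  (forall A, measurable A ->
    Phi (fun x => (\1_A x)%:E) u = Psi (fun x => (\1_A x)%:E) u) ->
  forall f, nnm f -> Phi f u = Psi f u.
Proof.
move=> [_ _ aP sP lP] [_ _ aQ sQ lQ] PQ; apply: nnm_ind => //.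
- by move=> f g nf ng fE gE; rewrite aP// aQ// fE gE.
- by move=> k f k0 nf fE; rewrite sP// sQ// fE.
- by move=> f_ nf ndf fE; rewrite lP// lQ//; under eq_fun do rewrite fE.
Qed.

Lemma kern_op_comp {d e d'} {T : measurableType d} {U : measurableType e}
    {W : measurableType d'}
    (Phi : (T -> \bar R) -> U -> \bar R) (Psi : (U -> \bar R) -> W -> \bar R) :
  kern_op Phi -> kern_op Psi -> kern_op (fun f => Psi (Phi f)).
Proof.
move=> [nP mP aP sP lP] [nQ mQ aQ sQ lQ]; split.
- by move=> f nf; exact/nQ/nP.
- move=> f h nf nh fh u; apply: mQ; [exact: nP|exact: nP|exact: mP].
- move=> f h nf nh u; rewrite -aQ; [|exact: nP|exact: nP].
  by congr (Psi _ u); apply/funext => x; exact: aP.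
- move=> k f k0 nf u; rewrite -sQ//; last exact: nP.
  by congr (Psi _ u); apply/funext => x; exact: sP.
- move=> f_ nf ndf u; rewrite -lQ.
  + by congr (Psi _ u); apply/funext => x; exact: lP.
  + by move=> n; exact: nP.
  + by move=> x n m nm; apply: mP => // y; exact: ndf.
Qed.

Lemma kern_op_add {d e} {T : measurableType d} {U : measurableType e}
    (Phi Psi : (T -> \bar R) -> U -> \bar R) :
  kern_op Phi -> kern_op Psi -> kern_op (fun f u => Phi f u + Psi f u).
Proof.
move=> [nP mP aP sP lP] [nQ mQ aQ sQ lQ]; split.
- by move=> f nf; apply: nnmD; [exact: nP|exact: nQ].
- by move=> f h nf nh fh u; apply: leeD; [exact: mP|exact: mQ].
- by move=> f h nf nh u; rewrite aP// aQ// addeACA.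
- move=> k f k0 nf u; rewrite sP// sQ// ge0_muleDr//.
    exact: (nP _ nf).2.
  exact: (nQ _ nf).2.
- move=> f_ nf ndf u; rewrite lP// lQ// limeD//.
  + by apply: ereal_nondecreasing_is_cvgn => n m nm; apply: mP => // x; exact: ndf.
  + by apply: ereal_nondecreasing_is_cvgn => n m nm; apply: mQ => // x; exact: ndf.
  + apply: ge0_adde_def; rewrite inE.
      by rewrite -lP//; apply: (nP _ _).2; exact: nnm_lim.
    by rewrite -lQ//; apply: (nQ _ _).2; exact: nnm_lim.
Qed.

Lemma kern_op0 {d e} {T : measurableType d} {U : measurableType e} :
  kern_op (fun (_ : T -> \bar R) (_ : U) => 0).
Proof.
split.
- by move=> f _; exact: nnm_cst.
- by [].
- by move=> *; rewrite adde0.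
- by move=> *; rewrite mule0.
- by move=> *; rewrite lim_cst.
Qed.

Lemma kern_op_sum {d e} {T : measurableType d} {U : measurableType e}
    (Phi : nat -> (T -> \bar R) -> U -> \bar R) n :
  (forall i, kern_op (Phi i)) ->
  kern_op (fun f u => \sum_(i < n) Phi i f u).
Proof.
move=> kP; elim: n => [|n IH].
  rewrite (_ : (fun _ => _) = (fun _ _ => 0)); first exact: kern_op0.
  by apply/funext => f; apply/funext => u; rewrite big_ord0.
rewrite (_ : (fun _ => _) =
    (fun f u => \sum_(i < n) Phi i f u + Phi n f u)); first exact: kern_op_add.
by apply/funext => f; apply/funext => u; rewrite big_ord_recr.
Qed.

(** Handles sums with a random number [N u] of terms. Measurability comes from a limit of sequences
    that are eventually constant; the other clauses hold at each [u] separately, with [n = N u]. *)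
Lemma kern_op_local {d e} {T : measurableType d} {U : measurableType e}
    (Phi : (T -> \bar R) -> U -> \bar R)
    (Psi : nat -> (T -> \bar R) -> U -> \bar R) (N : U -> nat) :
  (forall n, kern_op (Psi n)) ->
  (forall f u n, (N u <= n)%N -> Phi f u = Psi n f u) -> kern_op Phi.
Proof.
move=> kP PE; have PE' f u : Phi f u = Psi (N u) f u by exact: PE.
split.
- move=> f nf; split=> [|u]; last first.
    by rewrite PE'; have [nP _ _ _ _] := kP (N u); exact: (nP _ nf).2.
  apply: (emeasurable_fun_cvg (fun n => Psi n f)) => [n|u _].
    by have [nP _ _ _ _] := kP n; exact: (nP _ nf).1.
  apply: cvg_near_cst; exists (N u) => // n /= Nn.
  by apply/eqP; rewrite -PE.
- move=> f g nf ng fg u; rewrite !PE'.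
  by have [_ mP _ _ _] := kP (N u); exact: mP.
- move=> f g nf ng u; rewrite !PE'.
  by have [_ _ aP _ _] := kP (N u); exact: aP.
- move=> k f k0 nf u; rewrite !PE'.
  by have [_ _ _ sP _] := kP (N u); exact: sP.
- move=> f_ nf ndf u; rewrite PE'; under [in RHS]eq_fun do rewrite PE'.
  by have [_ _ _ _ lP] := kP (N u); exact: lP.
Qed.

(** The factor [c] may be [+oo]. The product is then continuous except at limit 0, where a
    nondecreasing nonnegative sequence vanishes identically. *)
Lemma limeMl_ge0 (c : \bar R) (u : nat -> \bar R) :
  0 <= c -> (forall n, 0 <= u n) -> {homo u : n m / (n <= m)%N >-> n <= m} ->
  limn (fun n => c * u n) = c * limn u.
Proof.
move=> c0 u0 ndu; have cu := ereal_nondecreasing_is_cvgn ndu.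
have [l0|l0] := eqVneq (limn u) 0.
  suff uE n : u n = 0.
    rewrite l0 mule0 (_ : (fun n => _) = cst 0) ?lim_cst//.
    by apply/funext => n; rewrite uE mule0.
  apply/eqP; rewrite eq_le u0 andbT -[leRHS]l0; apply: (cvge_to_ge cu).
  by exists n => // m /=; exact: ndu.
have [cf|cf] := boolP (c \is a fin_num); first by rewrite limeMl.
have cc : c @[_ --> \oo] --> c by exact: cvg_cst.
apply/cvg_lim => //; apply: cvgeM => //.
exact: mule_def_infty_neq0.
Qed.

(** The point mass at [xi u] with weight [c u]. Measurability is available only on [D], because
    particle [i] exists only where [i < N u]. *)
Lemma kern_op_pt {d e} {T : measurableType d} {U : measurableType e}
    (D : U -> bool) (c : U -> \bar R) (xi : U -> T) :
  measurable [set u | D u] ->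
  measurable_fun [set u | D u] c -> (forall u, D u -> 0 <= c u) ->
  measurable_fun [set u | D u] xi ->
  kern_op (fun f u => if D u then c u * f (xi u) else 0).
Proof.
move=> mD mc c0 mxi; split.
- move=> f [mf f0]; split=> [|u]; last first.
    by case: ifPn => // Du; apply: mule_ge0 => //; exact: c0.
  have DE : setT `&` D @^-1` [set true] = [set u | D u] by rewrite setTI.
  apply: measurable_fun_if => //.
  + by apply: (measurable_fun_bool true); rewrite DE.
  + rewrite DE; apply: emeasurable_funM => //.
    exact: (measurable_comp measurableT).
- move=> f g nf ng fg u; case: ifPn => // Du.
  by apply: lee_wpmul2l => //; exact: c0.
- move=> f g [_ f0] [_ g0] u; case: ifPn => Du; last by rewrite adde0.
  by rewrite ge0_muleDr.
- move=> k f k0 [_ f0] u; case: ifPn => Du; last by rewrite mule0.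
  by rewrite muleCA.
- move=> f_ nf ndf u; case: ifPn => Du; last by rewrite lim_cst.
  by rewrite limeMl_ge0//; [exact: c0|move=> n; exact: (nf n).2].
Qed.
Lemma nnm_if {d} {T : measurableType d} (D : T -> bool) (c : T -> \bar R) :
  measurable [set u | D u] -> measurable_fun [set u | D u] c ->
  (forall u, D u -> 0 <= c u) -> nnm (fun u => if D u then c u else 0).
Proof.
move=> mD mc c0.
(* The function cut to [D] is the point-mass operator applied to the constant 1. *)
have [nop _ _ _ _] := kern_op_pt D c id mD mc c0 (@measurable_id _ _ _).
have := nop (fun=> 1) (nnm_cst _ lee01).
by under eq_fun do rewrite mule1.
Qed.

End KernelOperators.

(** * Conditional expectation tested on the sets of a sub-sigma-algebra *)

Section ConditionalIdentities.
Local Open Scope ereal_scope.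
Context {R : realType}.

Lemma kern_op_integral {d e} {T : measurableType d} {U : measurableType e}
    (k : U -> {measure set T -> \bar R}) (A : set T) :
  (forall B, measurable B -> measurable_fun setT (fun u => k u B)) ->
  measurable A ->
  kern_op (fun f u => \int[k u]_(x in A) f x).
Proof.
move=> mk mA.
have mfA (f : T -> \bar R) : nnm f -> measurable_fun A f.
  by move=> nf; exact: measurable_funTS nf.1.
split.
- move=> f nf; split=> [|u]; last by apply: integral_ge0 => x _; exact: nf.2.
  under eq_fun do rewrite integral_mkcond.
  apply: measurable_fun_integral_kernel => //.
    by move=> x; apply: erestrict_ge0 => y _; exact: nf.2.
  by apply/(measurable_restrictT _ mA); exact: mfA.
- move=> f g nf ng fg u; apply: ge0_le_integral => // [x _||].
  + exact: nf.2.
  + exact: mfA.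
  + exact: mfA.
- move=> f g nf ng u; rewrite ge0_integralD// => [x _||x _|].
  + exact: nf.2.
  + exact: mfA.
  + exact: ng.2.
  + exact: mfA.
- move=> c f c0 nf u; rewrite ge0_integralZl// ?lee_fin//; first exact: mfA.
  by move=> x _; exact: nf.2.
- move=> f_ nf ndf u; rewrite monotone_convergence// => [n|n x _].
    exact: mfA.
  exact: (nf n).2.
Qed.

Lemma kern_op_measure {d e} {T : measurableType d} {U : measurableType e}
    (mu : {measure set T -> \bar R}) (A : set T) :
  measurable A -> kern_op (fun f (_ : U) => \int[mu]_(x in A) f x).
Proof. by move=> mA; apply: (kern_op_integral (fun=> mu)). Qed.

Context {d} {Om : measurableType d} (P : {measure set Om -> \bar R}).

Lemma sub_sigmaE (G : set (set Om)) (A : set Om) : sub_sigma G ->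
  measurable (A : set (g_sigma_algebraType G)) = G A.
Proof. by move=> [sG _]; rewrite measurable_g_measurableTypeE. Qed.

Lemma sub_sigma_id (G : set (set Om)) : sub_sigma G ->
  measurable_fun [set: Om] (id : Om -> g_sigma_algebraType G).
Proof.
by move=> sG _ B; rewrite sub_sigmaE// preimage_id setTI => GB; exact: sG.2.
Qed.

Lemma sub_sigma_nnm (G : set (set Om)) (f : g_sigma_algebraType G -> \bar R) :
  sub_sigma G -> nnm f -> nnm (f : Om -> \bar R).
Proof.
move=> sG [mf f0]; split => //.
exact: (measurableT_comp mf (sub_sigma_id _ sG)).
Qed.

Lemma Gmeasurable_fun {e} {Y : measurableType e} (G : set (set Om)) D (f : Om -> Y) :
  sub_sigma G -> Gmeasurable G D f ->
  measurable_fun (D : set (g_sigma_algebraType G)) f.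
Proof. by move=> sG [GD Gf] _ B mB; rewrite sub_sigmaE//; exact: Gf. Qed.

Lemma Gmeasurable_gt (G : set (set Om)) (N : Om -> nat) i :
  sub_sigma G -> Gmeasurable_nat G N -> G [set u | (i < N u)%N].
Proof.
move=> sG GN; rewrite -sub_sigmaE//.
rewrite (_ : [set u | _] = \bigcup_(k in [set k | (i < k)%N]) [set u | N u = k]).
  by apply: bigcup_measurable => k _; rewrite sub_sigmaE.
apply/seteqP; split=> [u iN|u [k ik Nk]]; first by exists (N u).
by move: ik; rewrite /= Nk.
Qed.

(* Equality of the conditional expectations of Z1 and Z2 given G. *)
Definition cond_eq (G : set (set Om)) (Z1 Z2 : Om -> \bar R) :=
  forall A, G A -> \int[P]_(x in A) Z1 x = \int[P]_(x in A) Z2 x.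

(** For fixed [A] and [Z], the integral of [phi * Z] over [A] is a kernel operator in [phi] on the
    sigma-algebra [G]. It suffices to take for [phi] the indicator of some [B] in [G], and then both
    integrals run over the intersection of [A] and [B], again in [G]. *)
Lemma cond_eqM (G : set (set Om)) (Z1 Z2 : Om -> \bar R)
    (phi : g_sigma_algebraType G -> \bar R) :
  sub_sigma G -> nnm Z1 -> nnm Z2 -> cond_eq G Z1 Z2 -> nnm phi ->
  cond_eq G (fun x => phi x * Z1 x) (fun x => phi x * Z2 x).
Proof.
move=> sG n1 n2 Z12 nphi A GA.
have mA : measurable A by exact: sG.2.
pose op (Z : Om -> \bar R) (f : g_sigma_algebraType G -> \bar R) (_ : Om) :=
  \int[P]_(x in A) (if true then Z x * f x else 0).
have kop Z : nnm Z -> kern_op (op Z).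
  move=> [mZ Z0].
  apply: (kern_op_comp _ _ (kern_op_pt (fun=> true) Z
                       (id : Om -> g_sigma_algebraType G) _ _ _ _)
                     (kern_op_measure P _ mA)) => //.
  - by rewrite (_ : [set u | true] = setT) //; apply/seteqP; split.
  - exact: measurable_funTS.
  - by apply: measurable_funTS; exact: sub_sigma_id.
have : op Z1 phi point = op Z2 phi point.
  apply: kern_op_ext; [exact: kop|exact: kop| |exact: nphi].
  move=> B; rewrite sub_sigmaE// => GB; rewrite /op.
  have E (Z : Om -> \bar R) : \int[P]_(x in A) (Z x * (\1_B x)%:E) = \int[P]_(x in A `&` B) Z x.
    by rewrite [RHS]integral_mkcondr; apply: eq_integral => x _; rewrite epatch_indic.
  rewrite !E; apply: Z12.
  by rewrite -sub_sigmaE//; apply: measurableI; rewrite sub_sigmaE.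
by rewrite /op => E; under eq_integral do rewrite muleC;
  under [RHS]eq_integral do rewrite muleC.
Qed.

Lemma cond_eq_sub (G H : set (set Om)) (Z1 Z2 : Om -> \bar R) :
  G `<=` H -> cond_eq H Z1 Z2 -> cond_eq G Z1 Z2.
Proof. by move=> GH HZ A /GH; exact: HZ. Qed.

Lemma cond_eq_trans (G : set (set Om)) (Z1 Z2 Z3 : Om -> \bar R) :
  cond_eq G Z1 Z2 -> cond_eq G Z2 Z3 -> cond_eq G Z1 Z3.
Proof. by move=> h1 h2 A GA; rewrite h1// h2. Qed.

Lemma cond_eq_nneseries (G : set (set Om)) (Z1 Z2 : nat -> Om -> \bar R) :
  sub_sigma G -> (forall i, nnm (Z1 i)) -> (forall i, nnm (Z2 i)) ->
  (forall i, cond_eq G (Z1 i) (Z2 i)) ->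
  cond_eq G (fun x => \sum_(i <oo) Z1 i x) (fun x => \sum_(i <oo) Z2 i x).
Proof.
move=> sG n1 n2 Z12 A GA.
have mA : measurable A by exact: sG.2.
rewrite !integral_nneseries//.
- by apply: eq_eseriesr => i _; exact: Z12.
- by move=> i; exact: measurable_funTS (n2 i).1.
- by move=> i x _; exact: (n2 i).2.
- by move=> i; exact: measurable_funTS (n1 i).1.
- by move=> i x _; exact: (n1 i).2.
Qed.

End ConditionalIdentities.

(** * Weighted empirical measures with a random number of particles *)

Section ParticleSums.
Local Open Scope ereal_scope.
Context {R : realType} {dX} {X : measurableType dX}.

Definition psum {U : Type} (N : U -> nat) (w : nat -> U -> R) (xi : nat -> U -> X)
    (h : X -> \bar R) (u : U) : \bar R :=
  \sum_(i < N u) (w i u)%:E * h (xi i u).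

Lemma psum_widen {U : Type} (N : U -> nat) w xi h (u : U) n : (N u <= n)%N ->
  psum N w xi h u =
  \sum_(i < n) (if (i < N u)%N then (w i u)%:E * h (xi i u) else 0).
Proof.
by move=> Nn; rewrite -big_mkcond/= /psum (big_ord_widen n (fun i => (w i u)%:E * h (xi i u))).
Qed.

Lemma sum_ord_nneseries (f : nat -> \bar R) n :
  \sum_(i < n) f i = \sum_(i <oo) (if (i < n)%N then f i else 0).
Proof.
apply/esym/cvg_lim => //; apply: cvg_near_cst; exists n => // k /= nk.
by rewrite big_mkord -big_mkcond/= (big_ord_widen k f).
Qed.

(** A series has a deterministic index range, so it can be exchanged with the integral. *)
Lemma psum_nneseries {U : Type} (N : U -> nat) w xi h (u : U) :
  psum N w xi h u =
  \sum_(i <oo) (if (i < N u)%N then (w i u)%:E * h (xi i u) else 0).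
Proof. exact: sum_ord_nneseries (fun i => (w i u)%:E * h (xi i u)) (N u). Qed.

Context {e} {U : measurableType e}.

Lemma kern_op_psum (N : U -> nat) (w : nat -> U -> R) (xi : nat -> U -> X) :
  (forall i, measurable [set u | (i < N u)%N]) ->
  (forall i, measurable_fun [set u | (i < N u)%N] (w i)) ->
  (forall i u, (i < N u)%N -> (0 <= w i u)%R) ->
  (forall i, measurable_fun [set u | (i < N u)%N] (xi i)) ->
  kern_op (psum N w xi).
Proof.
move=> mN mw w0 mxi.
apply: (kern_op_local _ (fun n h u =>
  \sum_(i < n) (if (i < N u)%N then (w i u)%:E * h (xi i u) else 0)) N).
- move=> n; apply: (kern_op_sum (fun i h u =>
    (if (i < N u)%N then (w i u)%:E * h (xi i u) else 0))) => i.
  apply: (kern_op_pt (fun u => (i < N u)%N) (fun u => (w i u)%:E)) => //.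
    exact/measurable_EFinP.
  by move=> u iN; rewrite lee_fin; exact: w0.
- by move=> h u n Nn; exact: psum_widen.
Qed.

End ParticleSums.

(** * Iterates of the transition kernel *)

Section KernelPowers.
Local Open Scope ereal_scope.
Context {R : realType} {dX} {X : measurableType dX} (K : R.-pker X ~> X).

Lemma kern_op_kpow t : kern_op (kpow_pos K t).
Proof.
elim: t => [|t IH]; first by split.
apply: (kern_op_comp _ _ IH (kern_op_integral (fun x => K x) _ _ measurableT)).
by move=> B mB; exact: measurable_kernel.
Qed.

(** The recursion of [kpow_pos] adds a step at the start of time, that of the particles adds one at
    the end. *)
Lemma kpow_posSr t h : kpow_pos K t.+1 h = kpow_pos K t (kpow_pos K 1 h).
Proof. by elim: t => // t IH; apply/funext => x /=; rewrite -IH. Qed.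

Lemma kpow_pos_cst t (c : \bar R) : kpow_pos K t (fun=> c) = fun=> c.
Proof.
elim: t => // t IH; apply/funext => x /=; rewrite IH integral_cst//.
by rewrite prob_kernel mule1.
Qed.

End KernelPowers.

(** * One step of the splitting method *)

Section Splitting.
Local Open Scope ereal_scope.
Context {R : realType}.

Lemma integral_if {d} {T : measurableType d} (P : {measure set T -> \bar R})
    (A : set T) (D : T -> bool) (g : T -> \bar R) :
  \int[P]_(x in A) (if D x then g x else 0) =
  \int[P]_(x in A `&` [set x | D x]) g x.
Proof.
rewrite [RHS]integral_mkcondr; apply: eq_integral => x _.
by rewrite /patch mem_setE.
Qed.

(** Groups the children by parent: [i] occurs as [par j] once per child of particle [i]. *)
Lemma sum_children (par : nat -> nat) (n m : nat) (g : nat -> \bar R) :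
  (forall j, (j < n)%N -> (par j < m)%N) ->
  \sum_(j < n) g (par j) =
  \sum_(i < m) ((count (fun j => par j == i) (iota 0 n))%:R)%:E * g i.
Proof.
move=> pm.
have -> : \sum_(j < n) g (par j) =
    \sum_(j < n) \sum_(i < m | par j == i :> nat) g i.
  apply: eq_bigr => j _.
  by rewrite (big_pred1 (Ordinal (pm j (ltn_ord j))))// => i; rewrite /= -val_eqE eq_sym.
rewrite (exchange_big_dep xpredT)//=; apply: eq_bigr => i _.
rewrite mule_natl -(big_mkord (fun j => par j == i) (fun=> g i)).
rewrite /index_iota subn0 big_const_seq.
by elim: (count _ _) => // k IH; rewrite iterS IH muleS.
Qed.

Context {dO} {Om : measurableType dO} {P : probability Om R}
  {dX} {X : measurableType dX} {K : R.-pker X ~> X} {mu0 : probability X R}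
  {N0 : nat} {N : nat -> Om -> nat}
  {xi : nat -> nat -> Om -> X} {w : nat -> nat -> Om -> R}
  {C : nat -> nat -> Om -> R} {M : nat -> nat -> Om -> nat}
  {xih : nat -> nat -> Om -> X} {wh : nat -> nat -> Om -> R}
  {F Fh : nat -> set (set Om)}
  (spl : splitting_method P K mu0 N0 N xi w C M xih wh F Fh).

Lemma split_sigmaF t : sub_sigma (F t).
Proof. by case: spl => /(_ t)[]. Qed.

Lemma split_sigmaFh t : sub_sigma (Fh t).
Proof. by case: spl => /(_ t)[]. Qed.

Lemma split_FFh t : F t `<=` Fh t.
Proof. by case: spl => /(_ t)[]. Qed.

Lemma split_FhF t : Fh t `<=` F t.+1.
Proof. by case: spl => /(_ t)[]. Qed.

Lemma split_F_mono s t : (s <= t)%N -> F s `<=` F t.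
Proof.
elim: t => [|t IH]; first by rewrite leqn0 => /eqP ->.
rewrite leq_eqVlt => /predU1P[->//|]; rewrite ltnS => /IH st.
by apply: (subset_trans st); apply: (subset_trans (split_FFh t)); exact: split_FhF.
Qed.

Lemma split_N t i : F t [set u | (i < N t u)%N].
Proof.
case: spl => _ _ /(_ t)[gN _ _ _ _] _; exact: Gmeasurable_gt (split_sigmaF t) gN.
Qed.

Lemma split_Nh t i : Fh t [set u | (i < N t.+1 u)%N].
Proof.
case: spl => _ _ /(_ t)[_ _ _ _ [_ _ gN _]] _.
exact: Gmeasurable_gt (split_sigmaFh t) gN.
Qed.

Lemma split_par t u : exists par : nat -> nat,
  (forall j, (j < N t.+1 u)%N ->
     [/\ (par j < N t u)%N, xih t j u = xi t (par j) u &
         wh t j u = w t (par j) u / C t (par j) u]%R) /\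
  (forall i, (i < N t u)%N ->
     count (fun j => par j == i) (iota 0 (N t.+1 u)) = M t i u).
Proof. by case: spl => _ _ /(_ t)[_ _ _ _ [_ /(_ u)]]. Qed.

Lemma split_C_gt0 t i u : (i < N t u)%N -> (0 < C t i u)%R.
Proof. by case: spl => _ _ /(_ t)[_ _ cp _ _] _; exact: cp. Qed.

Lemma split_wS t j u : (j < N t.+1 u)%N -> w t.+1 j u = wh t j u.
Proof. by case: spl => _ _ _ /(_ t)[wE _]; exact: wE. Qed.

Lemma split_w_gt0 t i u : (i < N t u)%N -> (0 < w t i u)%R.
Proof.
elim: t i => [|t IH] i.
  case: spl => _ [N0p NE wE _] _ _; rewrite NE => iN.
  by rewrite wE// invr_gt0 ltr0n.
move=> iN; rewrite split_wS//.
have [par [/(_ _ iN)[pN _ ->] _]] := split_par t u.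
by rewrite divr_gt0// ?IH// split_C_gt0.
Qed.

Lemma split_wh_gt0 t j u : (j < N t.+1 u)%N -> (0 < wh t j u)%R.
Proof. by move=> jN; rewrite -split_wS// split_w_gt0. Qed.

Local Notation OmF t := (g_sigma_algebraType (F t)).
Local Notation OmFh t := (g_sigma_algebraType (Fh t)).
Local Notation m t := (psum (N t) (w t) (xi t)).
Local Notation mh t := (psum (N t.+1) (wh t) (xih t)).

Lemma split_meas t i :
  [/\ measurable ([set u | (i < N t u)%N] : set (OmF t)),
      measurable_fun ([set u | (i < N t u)%N] : set (OmF t)) (xi t i),
      measurable_fun ([set u | (i < N t u)%N] : set (OmF t)) (w t i) &
      measurable_fun ([set u | (i < N t u)%N] : set (OmF t)) (C t i)].
Proof.
have sF := split_sigmaF t.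
case: spl => _ _ /(_ t)[_ /(_ i)[gx gw gC] _ _ _] _; split.
- by rewrite sub_sigmaE//; exact: split_N.
- exact: Gmeasurable_fun.
- exact: Gmeasurable_fun.
- exact: Gmeasurable_fun.
Qed.

Lemma split_meash t i :
  [/\ measurable ([set u | (i < N t.+1 u)%N] : set (OmFh t)),
      measurable_fun ([set u | (i < N t.+1 u)%N] : set (OmFh t)) (xih t i) &
      measurable_fun ([set u | (i < N t.+1 u)%N] : set (OmFh t)) (wh t i)].
Proof.
have sF := split_sigmaFh t.
case: spl => _ _ /(_ t)[_ _ _ _ [_ _ _ /(_ i)[gx gw]]] _; split.
- by rewrite sub_sigmaE//; exact: split_Nh.
- exact: Gmeasurable_fun.
- exact: Gmeasurable_fun.
Qed.

Lemma sub_sigma_meas_fun {e} {Y : measurableType e} (G : set (set Om))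
    (D : set Om) (f : Om -> Y) :
  sub_sigma G -> measurable (D : set (g_sigma_algebraType G)) ->
  measurable_fun (D : set (g_sigma_algebraType G)) f -> measurable_fun D f.
Proof.
by move=> sG mD mf _ B mB; have := mf mD B mB; rewrite sub_sigmaE// => /sG.2.
Qed.

Lemma kern_op_split t : kern_op (m t : _ -> OmF t -> \bar R).
Proof.
apply: kern_op_psum => i; try by have [] := split_meas t i.
by move=> u /split_w_gt0 /ltW.
Qed.

Lemma nnm_split t h : nnm h -> nnm (m t h : OmF t -> \bar R).
Proof. by move=> nh; have [nm _ _ _ _] := kern_op_split t; exact: nm. Qed.

(** Grouped by parent, the sum over children has terms [M t i] times the [F t]-measurable factor
    [w / C] times [h (xi t i)]. Under the conditional expectation [M] becomes [C], which cancels. *)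
Lemma splitting_step t h : nnm h -> cond_eq P (F t) (mh t h) (m t h).
Proof.
move=> nh.
pose phi i u := if (i < N t u)%N then (w t i u / C t i u)%:E * h (xi t i u) else 0.
pose Zm i u : \bar R := if (i < N t u)%N then ((M t i u)%:R)%:E else 0.
pose Zc i u : \bar R := if (i < N t u)%N then (C t i u)%:E else 0.
have nphi i : nnm (phi i : OmF t -> \bar R).
  have [mN mx mw mC] := split_meas t i.
  have [] := kern_op_pt (fun u : OmF t => (i < N t u)%N)
    (fun u => (w t i u / C t i u)%:E) (xi t i) mN => //.
  - apply/measurable_EFinP.
    (* Real powers are measurable, and where [i < N t u] the number [C t i u] is positive, so its
       inverse is the power of exponent -1. *)
    apply: (eq_measurable_fun (fun u : OmF t => w t i u * C t i u `^ (-1))%R).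
      by move=> u; rewrite inE => /split_C_gt0/ltW C0; rewrite powR_inv1.
    apply: measurable_funM => //.
    exact: (measurableT_comp (measurable_powR _) mC).
  - by move=> u iN; rewrite lee_fin ltW// divr_gt0// ?split_w_gt0// split_C_gt0.
  - by move=> nop _ _ _ _; exact: nop.
have mD i : measurable [set u | (i < N t u)%N].
  by apply: (split_sigmaF t).2; exact: split_N.
have nZm i : nnm (Zm i).
  apply: nnm_if => //.
  apply/measurable_EFinP => _ Y _.
    rewrite (_ : _ `&` _ = \bigcup_(k in [set k | Y k%:R])
       ([set u | (i < N t u)%N] `&` [set u | M t i u = k])).
      apply: bigcup_measurable => k _.
      by case: spl => _ _ /(_ t)[_ _ _ [/(_ i k)]].
    apply/seteqP; split=> [u [iN Yu]|u [k Yk [iN Mk]]]; first by exists (M t i u).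
    by split=> //=; rewrite Mk.
have nZc i : nnm (Zc i).
  have [mN mx mw mC] := split_meas t i.
  have mC' := sub_sigma_meas_fun _ _ _ (split_sigmaF t) mN mC.
  apply: nnm_if => //; first by apply/measurable_EFinP; exact: mC'.
  by move=> u iN; rewrite lee_fin ltW// split_C_gt0.
have Zmc i : cond_eq P (F t) (Zm i) (Zc i).
  move=> A FA; rewrite !integral_if.
  by case: spl => _ _ /(_ t)[_ _ _ [_ /(_ i A FA)]].
move=> A FA.
transitivity (\int[P]_(x in A) \sum_(i <oo) (phi i x * Zm i x)).
  apply: eq_integral => u _.
  have [par [parP parM]] := split_par t u.
  pose g i := (w t i u / C t i u)%:E * h (xi t i u).
  transitivity (\sum_(j < N t.+1 u) g (par j)).
    by apply: eq_bigr => j _; have [_ -> ->] := parP j (ltn_ord j).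
  rewrite (sum_children _ _ (N t u)); last by move=> j /parP[].
  transitivity (\sum_(i < N t u) ((M t i u)%:R)%:E * g i).
    by apply: eq_bigr => i _; rewrite parM.
  rewrite (sum_ord_nneseries (fun i => ((M t i u)%:R)%:E * g i)); apply: eq_eseriesr => i _.
  rewrite /phi /Zm; case: ifPn => iN; last by rewrite mul0e.
  by rewrite muleC.
rewrite (cond_eq_nneseries P (F t) _ (fun i x => phi i x * Zc i x))//.
- apply: eq_integral => u _; rewrite psum_nneseries; apply: eq_eseriesr => i _.
  rewrite /phi /Zc; case: ifPn => iN; last by rewrite mul0e.
  by rewrite muleAC -EFinM divfK// gt_eqF// split_C_gt0.
- exact: split_sigmaF.
- move=> i; apply: nnmM => //; exact: sub_sigma_nnm _ _ (split_sigmaF t) (nphi i).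
- move=> i; apply: nnmM => //; exact: sub_sigma_nnm _ _ (split_sigmaF t) (nphi i).
- by move=> i; apply: cond_eqM => //; exact: split_sigmaF.
Qed.

(** Both sides are sums over particles, so only the marginal law of each [xi t.+1 j] given [Fh t]
    matters. *)
Lemma evolution_step t h : nnm h ->
  cond_eq P (Fh t) (m t.+1 h) (mh t (kpow_pos K 1 h)).
Proof.
move=> nh; have sFh := split_sigmaFh t.
pose D j := [set u | (j < N t.+1 u)%N].
have mD j : measurable (D j) by apply: sFh.2; exact: split_Nh.
have nK f : nnm f -> nnm (kpow_pos K 1 f) by have [+ _ _ _ _] := kern_op_kpow K 1; exact.
have mxi j : measurable_fun (D j) (xi t.+1 j).
  have [mN mx _ _] := split_meas t.+1 j.
  exact: sub_sigma_meas_fun _ _ _ (split_sigmaF _) mN mx.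
have mxih j : measurable_fun (D j) (xih t j).
  have [mN mx _] := split_meash t j; exact: sub_sigma_meas_fun _ _ _ sFh mN mx.
have mwh j : measurable_fun (D j) (fun u => (wh t j u)%:E).
  apply/measurable_EFinP.
  have [mN _ mw] := split_meash t j; exact: sub_sigma_meas_fun _ _ _ sFh mN mw.
have wh0 j u : D j u -> 0 <= (wh t j u)%:E.
  by move=> /split_wh_gt0/ltW; rewrite lee_fin.
pose k1 j := kern_op_pt (fun u => (j < N t.+1 u)%N) _ _ (mD j) (mwh j) (wh0 j) (mxi j).
pose k2 j := kern_op_pt (fun u => (j < N t.+1 u)%N) _ _ (mD j) (mwh j) (wh0 j) (mxih j).
pose phi j u : \bar R := if (j < N t.+1 u)%N then (wh t j u)%:E else 0.
have nphi j : nnm (phi j : OmFh t -> \bar R).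
  have [mN _ mw] := split_meash t j.
  apply: (nnm_if (T := OmFh t)) => //; [exact/measurable_EFinP|exact: wh0].
pose Z1 j (B : set X) u : \bar R := if (j < N t.+1 u)%N then (\1_B (xi t.+1 j u))%:E else 0.
pose Z2 j (B : set X) u := if (j < N t.+1 u)%N then K (xih t j u) B else 0.
have Z12 j B : measurable B -> cond_eq P (Fh t) (Z1 j B) (Z2 j B).
  move=> mB A FA; rewrite /Z1 /Z2 !integral_if.
  have mA : measurable A by exact: sFh.2.
  have [_ _ _ /(_ t)[_ evo]] := spl.
  (* Marginal of particle [j]: the earlier particles are left unconstrained, so the product of
     kernels reduces to its last factor. *)
  pose B' i := if i == j then B else setT.
  have mB' i : measurable (B' i) by rewrite /B'; case: ifP.
  have := evo j.+1 A B' FA mB'.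
  have -> : [set om | (j < N t.+1 om)%N /\
      forall i, (i < j.+1)%N -> B' i (xi t.+1 i om)] = D j `&` xi t.+1 j @^-1` B.
    apply/seteqP; split=> [u [jN /(_ j (ltnSn j))]|u [jN Bu]].
      by rewrite /B' eqxx.
    by split=> // i _; rewrite /B'; case: eqP => [->|].
  have mE : measurable (D j `&` xi t.+1 j @^-1` B) by exact: (mxi j).
  rewrite setIC -integral_indic// => E.
  transitivity (\int[P]_(x in A) (\1_(D j `&` xi t.+1 j @^-1` B) x)%:E).
    rewrite -integral_if; apply: eq_integral => u _.
    rewrite !indicE; case: ifPn => jN; last by rewrite memNset// => -[/(negP jN)].
    by congr ((nat_of_bool _)%:R%:E); apply/idP/idP; rewrite !inE; [move=> Bu; split|case].
  rewrite E; apply: eq_integral => u _.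
  rewrite big_ord_recr /= big1 => [|i _]; last first.
    by rewrite /B' ltn_eqF// prob_kernel.
  rewrite mul1r /B' eqxx fineK// ge0_fin_numE//.
  apply: (@le_lt_trans _ _ (K (xih t j u) setT)); first by apply: le_measure; rewrite ?inE.
  by rewrite prob_kernel ltry.
have E j : cond_eq P (Fh t)
    (fun u => if (j < N t.+1 u)%N then (wh t j u)%:E * h (xi t.+1 j u) else 0)
    (fun u => if (j < N t.+1 u)%N then (wh t j u)%:E * kpow_pos K 1 h (xih t j u) else 0).
  move=> A FA; have mA : measurable A by exact: sFh.2.
  (* As functions of [h], both sides are kernels evaluated at a dummy argument; it remains to
     compare them on indicators. *)
  apply: (kern_op_ext _ _ (point : Om)
    (kern_op_comp _ _ (k1 j) (kern_op_measure P A mA))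
    (kern_op_comp _ _ (kern_op_kpow K 1)
      (kern_op_comp _ _ (k2 j) (kern_op_measure P A mA)))) => // B mB /=.
  have nZ1 : nnm (Z1 j B).
    apply: nnm_if => //.
      exact: mD.
    apply: (measurableT_comp (f := fun x => (\1_B x)%:E) _ (mxi j)).
    exact: (nnm_indic _ mB).1.
  have nZ2 : nnm (Z2 j B).
    apply: nnm_if => //; first exact: mD.
    exact: (measurableT_comp (measurable_kernel K B mB) (mxih j)).
  have := cond_eqM P _ _ _ _ sFh nZ1 nZ2 (Z12 j _ mB) (nphi j) _ FA.
  rewrite /phi /Z1 /Z2 => ZE.
  transitivity (\int[P]_(u in A) ((if (j < N t.+1 u)%N then (wh t j u)%:E else 0) *
    (if (j < N t.+1 u)%N then (\1_B (xi t.+1 j u))%:E else 0))).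
    by apply: eq_integral => u _; case: ifP; rewrite ?mul0e.
  rewrite ZE; apply: eq_integral => u _; case: ifP; rewrite ?mul0e// => _.
  by rewrite integral_indic// setIT.
move=> A FA.
under eq_integral do rewrite psum_nneseries.
under [RHS]eq_integral do rewrite psum_nneseries.
under eq_integral => u _.
  under eq_eseriesr => j _.
    rewrite (_ : (if _ then _ else _) = if (j < N t.+1 u)%N then (wh t j u)%:E * h (xi t.+1 j u) else 0); last first.
      by case: ifPn => // jN; rewrite split_wS.
    over.
  over.
apply: (cond_eq_nneseries P (Fh t)) => // j.
- by have [+ _ _ _ _] := k1 j; exact.
- by have [+ _ _ _ _] := k2 j; apply; exact: nK.
Qed.

End Splitting.

(** * The mass martingale *)

Section ParticleExpectations.
Local Open Scope ereal_scope.
Context {R : realType}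
  {dO} {Om : measurableType dO} {P : probability Om R}
  {dX} {X : measurableType dX} {K : R.-pker X ~> X} {mu0 : probability X R}
  {N0 : nat} {N : nat -> Om -> nat}
  {xi : nat -> nat -> Om -> X} {w : nat -> nat -> Om -> R}
  {C : nat -> nat -> Om -> R} {M : nat -> nat -> Om -> nat}
  {xih : nat -> nat -> Om -> X} {wh : nat -> nat -> Om -> R}
  {F Fh : nat -> set (set Om)}
  (spl : splitting_method P K mu0 N0 N xi w C M xih wh F Fh).

Local Notation m t := (psum (N t) (w t) (xi t)).

(** Tower property: conditioning on [Fh (s + r)], then on [F (s + r)], trades the last evolution and
    splitting steps for one application of [K]. *)
Lemma particle_cond s r h : nnm h ->
  cond_eq P (F s) (m (s + r) h) (m s (kpow_pos K r h)).
Proof.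
elim: r h => [|r IH] h nh; first by rewrite addn0.
have nK : nnm (kpow_pos K 1 h) by have [+ _ _ _ _] := kern_op_kpow K 1; exact.
rewrite addnS kpow_posSr; apply: cond_eq_trans (IH _ nK).
apply: (cond_eq_sub _ _ _ _ _ (split_F_mono spl _ _ (leq_addr r s))).
apply: cond_eq_trans (splitting_step spl _ _ nK).
apply: (cond_eq_sub _ _ _ _ _ (split_FFh spl (s + r))).
exact: (evolution_step spl).
Qed.

Lemma particle_cond_le s t h : (s <= t)%N -> nnm h ->
  cond_eq P (F s) (m t h) (m s (kpow_pos K (t - s) h)).
Proof. by move=> st nh; have := particle_cond s (t - s) h nh; rewrite subnKC. Qed.

Definition mass t u : R := (\sum_(i < N t u) w t i u)%R.

Lemma massE t u : (mass t u)%:E = m t (fun=> 1) u.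
Proof.
by rewrite /mass -sumEFin; apply: eq_bigr => i _; rewrite mule1.
Qed.

(** The case [h = 1], as [K] preserves constants. *)
Lemma mass_cond s t : (s <= t)%N ->
  cond_eq P (F s) (fun u => (mass t u)%:E) (fun u => (mass s u)%:E).
Proof.
move=> st A FA.
have n1 : nnm (fun _ : X => 1 : \bar R) by exact: nnm_cst.
under eq_integral do rewrite massE.
rewrite (particle_cond_le _ _ _ st n1 _ FA) kpow_pos_cst.
by apply: eq_integral => u _; rewrite massE.
Qed.

Lemma nnm_massF t :
  nnm ((fun u => (mass t u)%:E) : g_sigma_algebraType (F t) -> \bar R).
Proof.
under eq_fun do rewrite massE.
exact: (nnm_split spl t _ (nnm_cst _ lee01)).
Qed.

Lemma nnm_mass t : nnm (fun u => (mass t u)%:E : \bar R).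
Proof. exact: (sub_sigma_nnm _ _ (split_sigmaF spl t) (nnm_massF t)). Qed.

Lemma mass_ge0 t u : (0 <= mass t u)%R.
Proof. by have := (nnm_mass t).2 u; rewrite lee_fin. Qed.

Lemma measurable_mass t : measurable_fun setT (mass t).
Proof. by have := (nnm_mass t).1 => /measurable_EFinP. Qed.

Lemma mass0 u : mass 0 u = 1%R.
Proof.
case: spl => _ [N0p NE wE _] _ _.
rewrite /mass NE (eq_bigr (fun=> N0%:R^-1)%R) => [|i _]; last by rewrite wE.
by rewrite sumr_const card_ord -[RHS](@mulVf _ (N0%:R : R)) ?mulr_natr// pnatr_eq0 -lt0n.
Qed.

Lemma integral_mass t : \int[P]_u (mass t u)%:E = 1.
Proof.
have FT : F 0 setT.
  rewrite -(sub_sigmaE _ _ (split_sigmaF spl 0)); exact: measurableT.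
rewrite (mass_cond _ _ (leq0n t) _ FT).
under eq_integral do rewrite mass0.
by rewrite (_ : (fun=> 1%:E) = cst 1)// integral_cst// mul1e; exact: probability_setT.
Qed.

End ParticleExpectations.

(** * Almost sure events and equalities *)

Section AlmostSure.
Local Open Scope ereal_scope.
Context {R : realType} {d} {T : measurableType d} (P : probability T R).

Lemma measurable_gtr (f : T -> R) c :
  measurable_fun setT f -> measurable [set x | (c < f x)%R].
Proof.
move=> mf; rewrite (_ : [set x | _] = setT `&` f @^-1` `]c, +oo[%classic).
  exact: mf.
by apply/seteqP; split=> x /=; rewrite in_itv/= andbT; [split|case].
Qed.

Lemma measurable_ltr (f : T -> R) c :
  measurable_fun setT f -> measurable [set x | (f x < c)%R].
Proof.
move=> mf; rewrite (_ : [set x | _] = setT `&` f @^-1` `]-oo, c[%classic).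
  exact: mf.
by apply/seteqP; split=> x /=; rewrite in_itv/=; [split|case].
Qed.

Lemma prob1_ae (E : set T) : measurable E ->
  P E = 1 <-> {ae P, forall x, E x}.
Proof.
move=> mE; have mC : measurable (~` E) by exact: measurableC.
suff -> : P E = 1 <-> P (~` E) = 0 by rewrite -(negligibleP _ mC).
rewrite probability_setC//; split=> [->|]; first by rewrite subee.
have := fin_num_measure P _ mE; case: (P E) => // r _.
by rewrite -EFinB => -[] /eqP; rewrite subr_eq0 => /eqP ->.
Qed.

(** The nonnegative function [g - f] has integral zero over [A]; the finite integral of [f] can be
    subtracted. *)
Lemma ae_eq_of_integral_le (A : set T) (f g : T -> \bar R) : measurable A ->
  nnm f -> nnm g -> (forall x, f x \is a fin_num) -> (forall x, A x -> f x <= g x) ->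
  \int[P]_(x in A) f x < +oo ->
  \int[P]_(x in A) g x <= \int[P]_(x in A) f x ->
  {ae P, forall x, A x -> f x = g x}.
Proof.
move=> mA nf ng ff fg If Igf.
have mf := measurable_funTS (D := A) nf.1; have mg := measurable_funTS (D := A) ng.1.
have mgf : measurable_fun A (fun x => g x - f x) by exact: emeasurable_funB.
have gf0 x : A x -> 0 <= g x - f x by move=> Ax; rewrite sube_ge0// ?ff ?fg.
have E : \int[P]_(x in A) (g x - f x) + \int[P]_(x in A) f x = \int[P]_(x in A) g x.
  rewrite -ge0_integralD//; last by move=> x _; exact: nf.2.
  by apply: eq_integral => x _; rewrite subeK.
have I0 : \int[P]_(x in A) (g x - f x) = 0.
  apply/eqP; rewrite eq_le integral_ge0 ?andbT//.
  rewrite -(@leeD2rE _ (\int[P]_(x in A) f x)); first by rewrite add0e E.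
  by rewrite ge0_fin_numE// integral_ge0// => x _; exact: nf.2.
have : \int[P]_(x in A) `|g x - f x| = 0.
  by rewrite -[RHS]I0; apply: eq_integral => x; rewrite inE => Ax; rewrite gee0_abs ?gf0.
move/(ae_eq_integral_abs P mA mgf); apply: filterS => x gfx Ax.
by rewrite -[RHS](@subeK _ _ (f x))// (gfx Ax) add0e.
Qed.

End AlmostSure.

(** * Unit mass from convergence in probability of the mean mass *)

Section Implications.
Local Open Scope ereal_scope.
Context {R : realType}
  {dO} {Om : measurableType dO} {P : probability Om R}
  {dX} {X : measurableType dX} {K : R.-pker X ~> X} {mu0 : probability X R}
  {N0 : nat} {N : nat -> Om -> nat}
  {xi : nat -> nat -> Om -> X} {w : nat -> nat -> Om -> R}
  {C : nat -> nat -> Om -> R} {M : nat -> nat -> Om -> nat}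
  {xih : nat -> nat -> Om -> X} {wh : nat -> nat -> Om -> R}
  {F Fh : nat -> set (set Om)}
  (spl : splitting_method P K mu0 N0 N xi w C M xih wh F Fh).

Local Notation S t := (mass (N := N) (w := w) t).

Definition mean_mass T u : R := (T%:R^-1 * \sum_(t < T) S t u)%R.

Lemma measurable_mean_mass T : measurable_fun setT (mean_mass T).
Proof.
apply: measurable_funM => //; apply: measurable_sum => t.
exact: (measurable_mass spl).
Qed.

Lemma measurable_deviation T (eps : R) :
  measurable [set u | (eps < `|mean_mass T u - 1|)%R].
Proof.
apply: measurable_gtr; apply: measurableT_comp => //; apply: measurable_funB => //.
exact: measurable_mean_mass.
Qed.

Lemma integral_sum_mass A n : measurable A ->
  \int[P]_(u in A) (\sum_(t < n) S t u)%:E = \sum_(t < n) \int[P]_(u in A) (S t u)%:E.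
Proof.
move=> mA; under eq_integral do rewrite -sumEFin.
rewrite ge0_integral_sum//.
- by move=> t; exact: measurable_funTS (nnm_mass spl t).1.
- by move=> t u _; exact: (nnm_mass spl t).2.
Qed.

(** Let [j n] be the integral over [A] of the mass at time [n]; it is constant from [t] on. Off the
    deviation event the mean mass is at least [1 - e], so [(1 - e) (P A - P bad)] is at most the
    average of [j], itself at most [t / (n + 1) + j t]. Then [n] tends to infinity and [e] to 0. *)
Lemma measure_le_integral_mass t A : F t A ->
  (forall eps : R, (0 < eps)%R ->
    P [set u | (eps < `|mean_mass T u - 1|)%R] @[T --> \oo] --> 0) ->
  P A <= \int[P]_(u in A) (S t u)%:E.
Proof.
move=> FA dev; have mA : measurable A by exact: (split_sigmaF spl t).2.
have jfin n : \int[P]_(u in A) (S n u)%:E <= 1.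
  rewrite -(integral_mass spl n); apply: ge0_subset_integral => //.
    exact: (nnm_mass spl n).1.
  by move=> u _; exact: (nnm_mass spl n).2.
pose j n := fine (\int[P]_(u in A) (S n u)%:E).
have jE n : \int[P]_(u in A) (S n u)%:E = (j n)%:E.
  rewrite /j fineK// ge0_fin_numE; first exact: le_lt_trans (jfin n) (ltry _).
  by apply: integral_ge0 => u _; exact: (nnm_mass spl n).2.
have j0 n : (0 <= j n)%R.
  by apply: fine_ge0; apply: integral_ge0 => u _; exact: (nnm_mass spl n).2.
(* Before time [t] the bound [j n <= 1] is used; at most [t] such terms enter the average. *)
have jt n : (j n <= (n < t)%:R + j t)%R.
  case: ltnP => nt; last by rewrite add0r /j (mass_cond spl _ _ nt _ FA).
  by rewrite (@le_trans _ _ 1%R) ?lerDl// -lee_fin -jE.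
apply/lee_addgt0Pr => e e0.
(* For [e >= 1] the claim is trivial; afterwards [1 - e] is positive. *)
have [e1|e1] := leP 1%R e.
  apply: (@le_trans _ _ 1); first exact: probability_le1.
  by rewrite jE -EFinD lee_fin (le_trans e1)// lerDr.
pose bad n := [set u | (e < `|mean_mass n u - 1|)%R].
have mbad n : measurable (bad n) by exact: measurable_deviation.
pose p := fine (P A); pose b n := fine (P (bad n)).
have pE : P A = p%:E by rewrite /p fineK// fin_num_measure.
have bE n : P (bad n) = (b n)%:E by rewrite /b fineK// fin_num_measure.
have main n : ((1 - e) * (p - b n.+1) <= t%:R * n.+1%:R^-1 + j t)%R.
  have lo : (n.+1%:R * (1 - e))%:E * P (A `\` bad n.+1) <= (\sum_(s < n.+1) j s)%:E.
    have -> : (\sum_(s < n.+1) j s)%:E = \int[P]_(u in A) (\sum_(s < n.+1) S s u)%:E.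
      by rewrite integral_sum_mass// -sumEFin; apply: eq_bigr => s _; rewrite jE.
    rewrite -(integral_cst P (measurableD mA (mbad n.+1))).
    have mS : measurable_fun setT (fun u => (\sum_(s < n.+1) S s u)%:E).
      apply/measurable_EFinP/measurable_sum => s; exact: (measurable_mass spl).
    have S0 u : 0 <= (\sum_(s < n.+1) S s u)%:E.
      by rewrite lee_fin sumr_ge0// => s _; exact: (mass_ge0 spl).
    apply: (@le_trans _ _ (\int[P]_(u in A `\` bad n.+1) (\sum_(s < n.+1) S s u)%:E)).
      apply: ge0_le_integral => //.
      - exact: measurableD.
      - by move=> u _; rewrite lee_fin mulr_ge0// subr_ge0 ltW.
      - exact: measurable_funTS.
      - move=> u [Au /negP]; rewrite -leNgt /mean_mass ler_norml => /andP[+ _].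
        by rewrite lerBrDl mulrC ler_pdivlMr// mulrC lee_fin.
    apply: ge0_subset_integral => //; [exact: measurableD|exact: measurable_funTS].
  have hi : (\sum_(s < n.+1) j s <= t%:R + n.+1%:R * j t)%R.
    apply: (@le_trans _ _ (\sum_(s < n.+1) ((s < t)%:R + j t))%R).
      by apply: ler_sum => s _; exact: jt.
    rewrite big_split/= sumr_const card_ord mulr_natl lerD2r -natr_sum ler_nat.
    suff -> : (\sum_(s < n.+1) (s < t))%N = minn n.+1 t by exact: geq_minr.
    elim: n.+1 => [|k IH]; first by rewrite big_ord0 min0n.
    by rewrite big_ord_recr/= IH; case: ltnP; lia.
  have pd : P A <= P (A `\` bad n.+1) + P (bad n.+1).
    apply: (le_trans _ (measureU2 _ _ _)) => //; last exact: measurableD.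
    apply: le_measure; rewrite ?inE//; first by apply: measurableU => //; exact: measurableD.
    by move=> u Au; have [?|?] := pselect (bad n.+1 u); [right|left].
  have dE : P (A `\` bad n.+1) = (fine (P (A `\` bad n.+1)))%:E.
    by rewrite fineK// fin_num_measure//; exact: measurableD.
  move: lo pd; rewrite pE bE dE -EFinM -EFinD !lee_fin; move: (fine _) => q lo pd.
  rewrite -(@ler_pM2l _ n.+1%:R)//.
  have -> : (n.+1%:R * (t%:R * n.+1%:R^-1 + j t) = t%:R + n.+1%:R * j t)%R.
    by rewrite mulrDr mulrCA mulfV ?mulr1// pnatr_eq0.
  apply: (le_trans _ hi); apply: (le_trans _ lo).
  by rewrite -mulrA !ler_wpM2l// ?lerBlDr// subr_ge0 ltW.
have b0 : b n.+1 @[n --> \oo] --> 0%R.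
  have := dev e e0; rewrite -[0]/(0%R%:E) => /fine_cvgP[_].
  by rewrite -(cvg_shiftS).
have L1 : ((1 - e) * (p - b n.+1))%R @[n --> \oo] --> ((1 - e) * (p - 0))%R.
  by apply: cvgM; [exact: cvg_cst|apply: cvgB => //; exact: cvg_cst].
have L2 : (t%:R * n.+1%:R^-1 + j t)%R @[n --> \oo] --> (t%:R * 0 + j t)%R.
  apply: cvgD; last exact: cvg_cst.
  by apply: cvgM; [exact: cvg_cst|exact: cvg_harmonic].
have le1 : ((1 - e) * p <= j t)%R.
  rewrite -[p]subr0 -[leRHS]add0r -[X in (_ <= X + _)%R](mulr0 t%:R).
  by apply: (ler_cvg_to L1 L2); exact: nearW.
rewrite jE pE -EFinD lee_fin.
have p1 : (p <= 1)%R by rewrite -lee_fin -pE probability_le1.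
have ep : (e * p <= e)%R by rewrite ler_piMr// ltW.
by rewrite -lerBlDr; apply: le_trans le1; rewrite mulrBl mul1r lerD2l lerN2.
Qed.

(** On [A] the mass is below 1 yet integrates to at least [P A]. As the total integral is 1, the
    complement is left with at most its own probability, although the mass there is at least 1. Both
    comparisons must be equalities almost surely. *)
Lemma mass_eq1_of_mean :
  (forall eps : R, (0 < eps)%R ->
    P [set u | (eps < `|mean_mass T u - 1|)%R] @[T --> \oo] --> 0) ->
  P [set u | forall t, S t u = 1%R] = 1.
Proof.
move=> dev; apply/prob1_ae.
  rewrite (_ : [set u | _] = \bigcap_t [set u | S t u = 1%R]); last first.
    by apply/seteqP; split=> u /= Su; [move=> t _; exact: Su|move=> t; exact: Su].
  apply: bigcap_measurable => // t _; rewrite -[X in measurable X]setTI.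
  exact: (measurable_mass spl t measurableT _ (measurable_set1 1%R)).
apply: (ae_foralln (P := fun t u => S t u = 1%R)) => t.
pose A := [set u | (S t u < 1)%R].
have sF := split_sigmaF spl t.
have FA : F t A.
  rewrite -(sub_sigmaE _ _ sF); apply: (measurable_ltr (T := g_sigma_algebraType (F t))).
  by apply/measurable_EFinP; exact: (nnm_massF spl t).1.
have FC : F t (~` A).
  by rewrite -(sub_sigmaE _ _ sF); apply: measurableC; rewrite (sub_sigmaE _ _ sF).
have mA : measurable A by exact: (split_sigmaF spl t).2.
have mC : measurable (~` A) by exact: measurableC.
have nS := nnm_mass spl t; have n1 : nnm (fun _ : Om => 1 : \bar R) by exact: nnm_cst.
have IA := measure_le_integral_mass t A FA dev.
have IC := measure_le_integral_mass t (~` A) FC dev.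
have IT : \int[P]_(u in A) (S t u)%:E + \int[P]_(u in ~` A) (S t u)%:E = 1.
  rewrite -ge0_integral_setU//.
  - by rewrite setUv; exact: (integral_mass spl).
  - by rewrite setUv; exact: nS.1.
  - by move=> u _; exact: nS.2.
  - by apply/disj_setPS => u [].
have ltA : \int[P]_(u in A) (S t u)%:E < +oo.
  by rewrite (le_lt_trans _ (ltry 1))// -IT leeDl// integral_ge0// => u _; exact: nS.2.
have aeA : {ae P, forall u, A u -> (S t u)%:E = 1}.
  apply: ae_eq_of_integral_le => //.
  - by move=> u /ltW; rewrite lee_fin.
  - by rewrite integral_cst// mul1e.
have aeC : {ae P, forall u, (~` A) u -> 1 = (S t u)%:E}.
  apply: ae_eq_of_integral_le => //.
  - by move=> u /negP; rewrite -leNgt lee_fin.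
  - by rewrite integral_cst// mul1e ltey_eq fin_num_measure.
  - have -> : \int[P]_(u in ~` A) 1 = P (~` A) by rewrite integral_cst// mul1e.
    rewrite probability_setC//.
    rewrite leeBrDr ?fin_num_measure// -IT addeC.
    exact: leeD.
apply: filterS2 aeA aeC => u SA SC.
have [Au|Au] := pselect (A u); first by case: (SA Au).
by case: (SC Au).
Qed.

(** The events [G n] of a deviation at some time [k >= n] decrease to a null set, so their
    probabilities tend to 0. *)
Lemma ae_cvg_in_probability (Y : nat -> Om -> R) (a : R) (eps : R) :
  (forall n, measurable_fun setT (Y n)) ->
  {ae P, forall u, Y n u @[n --> \oo] --> a} -> (0 < eps)%R ->
  P [set u | (eps < `|Y n u - a|)%R] @[n --> \oo] --> 0.
Proof.
move=> mY Ya e0.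
pose B n := [set u | (eps < `|Y n u - a|)%R].
have mB n : measurable (B n).
  apply: measurable_gtr.
  by apply: measurableT_comp => //; apply: measurable_funB.
pose G n := \bigcup_(k in [set k | (n <= k)%N]) B k.
have mG n : measurable (G n) by apply: bigcup_measurable => k _; exact: mB.
have PG : P (\bigcap_n G n) = 0.
  apply/(negligibleP _ (bigcapT_measurable mG)).
  apply: negligibleS Ya => u /= Gu Yu.
  have /cvgrPdist_le /(_ _ e0)[n _ Hn] := Yu.
  have [k /= nk] := Gu n I; rewrite /B /= distrC ltNge; exact/negP/negPn/Hn.
have PG0 : P (G 0%N) < +oo -> nonincreasing_seq G -> P (G n) @[n --> \oo] --> 0.
  by move=> G0 ndG; rewrite -PG; apply: nonincreasing_cvg_mu => //; exact: bigcapT_measurable.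
apply: (squeeze_cvge (f := fun=> 0) (h := P \o G)).
- near=> n; apply/andP; split; first exact: measure_ge0.
  apply: le_measure; rewrite ?inE; [exact: (mB n)|exact: mG|].
  by move=> u Bu; exists n => //=.
- exact: cvg_cst.
- apply: PG0; first by rewrite ltey_eq fin_num_measure.
  move=> n k nk; apply/subsetPset => u [j /= kj Bj]; exists j => //=.
  exact: leq_trans kj.
Unshelve. all: end_near. Qed.

End Implications.

(** * Ergodicity *)

Section ErgodicBounds.
Local Open Scope ereal_scope.
Context {R : realType} {dX} {X : measurableType dX} {K : R.-pker X ~> X}
  {mu : probability X R} {V : X -> \bar R}.
Context (Rc rho : R) (Rc0 : (0 < Rc)%R) (rho0 : (0 < rho)%R) (rho1 : (rho < 1)%R).
Context (mV : measurable_fun setT V) (V1 : forall x, 1 <= V x).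
Context (IV : \int[mu]_x V x < +oo).
Context (ergV : forall g : X -> R, measurable_fun setT g ->
  (forall x, (`|g x|)%:E <= V x) -> forall x t,
  `| kpow K t g x - \int[mu]_y (g y)%:E | <= (Rc * rho ^+ t)%:E * V x).

Lemma V_ge0 x : 0 <= V x.
Proof. exact: le_trans (V1 x). Qed.

Lemma nnmV : nnm V.
Proof. by split => // x; exact: V_ge0. Qed.

Lemma nnm_EFin (g : X -> R) : measurable_fun setT g -> (forall x, 0 <= g x)%R ->
  nnm (EFin \o g).
Proof.
by move=> mg g0; split=> [|x]; [exact/measurable_EFinP|rewrite lee_fin].
Qed.

Lemma lee_abs_sub (a b c : \bar R) : 0 <= a -> b \is a fin_num ->
  `|a - b| <= c -> a <= b + c /\ b <= a + c.
Proof.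
case: b => // b; case: a => [a||] // a0 _; case: c => [c||] //= H.
- move: H; rewrite -!EFinD !lee_fin ler_norml => /andP[? ?]; split; lra.
- by rewrite !addey// !leey.
- by rewrite addey// addye// !leey.
Qed.

(** For [g >= 0] the negative part in [kpow] vanishes. The absolute value is opened into two
    inequalities free of subtraction, which remain meaningful where [V] is [+oo]. *)
Lemma kpow_nonneg_bound (g : X -> R) t x : measurable_fun setT g ->
  (forall x, 0 <= g x)%R -> (forall x, (g x)%:E <= V x) ->
  let a := \int[mu]_y (g y)%:E in
  [/\ a \is a fin_num,
      kpow_pos K t (EFin \o g) x <= a + (Rc * rho ^+ t)%:E * V x &
      a <= kpow_pos K t (EFin \o g) x + (Rc * rho ^+ t)%:E * V x].
Proof.
move=> mg g0 gV a.
have fa : a \is a fin_num.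
  rewrite ge0_fin_numE; last by apply: integral_ge0 => y _; rewrite lee_fin.
  apply: le_lt_trans IV; apply: ge0_le_integral => //.
  - by move=> y _; rewrite lee_fin.
  - exact/measurable_EFinP.
have := ergV g mg _ x t; rewrite /kpow.
have -> : (fun y => (Num.max (g y) 0)%:E) = EFin \o g.
  by apply/funext => y; rewrite /= max_l.
have -> : (fun y => (Num.max (- g y) 0)%:E) = fun=> 0.
  by apply/funext => y; rewrite /= max_r// oppr_le0.
rewrite kpow_pos_cst sube0 => H.
have [nK _ _ _ _] := kern_op_kpow K t.
have K0 := (nK _ (nnm_EFin _ mg g0)).2 x.
have [|Kle Kge] := lee_abs_sub _ _ _ K0 fa (H _) => //.
by move=> y; rewrite ger0_norm.
Qed.

Import HBNNSimple.

(** Ergodicity concerns real functions below [V], and [V] may be infinite: it is applied to simple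
    functions increasing to [V]. The constant comes from [mu(g) <= mu(V) <= mu(V) V], as [V >= 1],
    and from [rho ^+ t <= 1]. *)
Lemma kpow_V_le t x :
  kpow_pos K t V x <= (fine (\int[mu]_y V y) + Rc)%:E * V x.
Proof.
have [nK leK _ _ limK] := kern_op_kpow K t.
pose g n := nnsfun_approx measurableT mV n.
have gx y : (g n y)%:E @[n --> \oo] --> V y.
  by apply: cvg_nnsfun_approx => // z _; exact: V_ge0.
have ndg y : {homo (fun n => (g n y)%:E) : n m / (n <= m)%N >-> n <= m}.
  by move=> n m nm; rewrite lee_fin; exact/lefP/nd_nnsfun_approx.
have gV n y : (g n y)%:E <= V y.
  apply: (cvge_to_ge (gx y)); exists n => // m /= nm; exact: ndg.
have nng n : nnm (EFin \o g n).
  by apply: nnm_EFin => // y; exact: fun_ge0.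
have VE : V = fun y => limn (fun n => (g n y)%:E).
  by apply/funext => y; apply/esym/cvg_lim => //; exact: gx.
rewrite [X in kpow_pos K t X]VE (limK (fun n => EFin \o g n))//.
apply: lime_le.
  by apply: ereal_nondecreasing_is_cvgn => n m nm; apply: leK => // y; exact: ndg.
apply: nearW => n.
have [//|y|_ + _] := kpow_nonneg_bound (g n) t x _ _ (gV n).
  exact: fun_ge0.
move=> /le_trans; apply.
have IV0 : (0 <= fine (\int[mu]_y V y))%R.
  by apply: fine_ge0; apply: integral_ge0 => y _; exact: V_ge0.
rewrite EFinD ge0_muleDl ?lee_fin ?(ltW Rc0)//.
apply: leeD.
  rewrite fineK ?ge0_fin_numE ?integral_ge0// => [|y _]; last exact: V_ge0.
  apply: (@le_trans _ _ (\int[mu]_y V y)).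
    apply: ge0_le_integral => // [y _|]; last exact: (nng n).1.
    by rewrite lee_fin fun_ge0.
  by apply: lee_pemulr => //; apply: integral_ge0 => y _; exact: V_ge0.
apply: lee_wpmul2r; first exact: V_ge0.
by rewrite lee_fin ler_piMr ?(ltW Rc0)// exprn_ile1// ltW.
Qed.

Context (f : X -> R) (mf : measurable_fun setT f) (f0 : (forall x, 0 <= f x)%R).
Context (f2V : forall x, (f x ^+ 2)%:E <= V x).

(** Either [f <= c] or [f <= f ^+ 2 / c]. With [c] the square root of an average of [V], this does
    the work of the Cauchy-Schwarz inequality. *)
Lemma f_le_affine (c : R) x : (0 < c)%R ->
  (f x)%:E <= c%:E + (c^-1)%:E * V x.
Proof.
move=> c0.
have [fc|fc] := leP (f x) c.
  rewrite -[leLHS]adde0 leeD ?lee_fin// mule_ge0 ?lee_fin ?invr_ge0 ?(ltW c0)//.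
  exact: V_ge0.
rewrite -[leLHS]add0e leeD ?lee_fin ?(ltW c0)//.
apply: (@le_trans _ _ ((c^-1)%:E * (f x ^+ 2)%:E)).
  by rewrite -EFinM lee_fin ler_pdivlMl// expr2 ler_wpM2r// ltW.
by rewrite lee_wpmul2l ?lee_fin ?invr_ge0 ?(ltW c0).
Qed.

Lemma f_leV x : (f x)%:E <= V x.
Proof.
have [f1|f1] := leP (f x) 1%R; first by apply: le_trans (V1 x); rewrite lee_fin.
by apply: le_trans (f2V x); rewrite lee_fin expr2 ler_peMl ?f0 ?(ltW f1).
Qed.

Let a := \int[mu]_y (f y)%:E.

Lemma f_mean_fin : a \is a fin_num.
Proof. by have [] := kpow_nonneg_bound f 0 point mf f0 f_leV. Qed.

Lemma kpow_f_ge t x : a <= kpow_pos K t (EFin \o f) x + (Rc * rho ^+ t)%:E * V x.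
Proof. by have [] := kpow_nonneg_bound f t x mf f0 f_leV. Qed.

(* The truncation level b is free: choosing it proportional to the square root
   of V gives the ergodicity of K in the weight sqrt V. *)
Lemma kpow_f_le t x (b : R) : (0 < b)%R ->
  kpow_pos K t (EFin \o f) x <=
  a + b%:E + (Rc * rho ^+ t / b)%:E * V x.
Proof.
move=> b0.
have [nK leK addK scaleK _] := kern_op_kpow K t.
(* [h / b] is the part of [f] above level [b]. Since [b (f - b) <= f ^+ 2], ergodicity applies to
   [h], with an error then divided by [b]; and [h / b <= f] keeps the mean below [a]. *)
pose h x := (b * Num.max (f x - b) 0)%R.
have h0 y : (0 <= h y)%R by rewrite mulr_ge0 ?(ltW b0)// le_max lexx orbT.
have hf y : (h y <= b * f y)%R.
  by rewrite ler_pM2l// ge_max f0 andbT lerBlDr lerDl ltW.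
have mh : measurable_fun setT h.
  apply: measurable_funM => //; apply: measurable_maxr => //.
  exact: measurable_funB.
have hV y : (h y)%:E <= V y.
  apply: le_trans (f2V y); rewrite lee_fin /h.
  have [fb|fb] := leP (f y - b)%R 0%R; first by rewrite mulr0 sqr_ge0.
  have := f0 y; nra.
have nh := nnm_EFin _ mh h0.
have [fh Kh _] := kpow_nonneg_bound h t x mh h0 hV.
have nbh : nnm (fun y => (b^-1)%:E * (h y)%:E).
  by apply: nnmM => //; apply: nnm_cst; rewrite lee_fin invr_ge0 ltW.
have nb : nnm (fun _ : X => b%:E) by apply: nnm_cst; rewrite lee_fin ltW.
apply: (@le_trans _ _ (kpow_pos K t (fun y => b%:E + (b^-1)%:E * (h y)%:E) x)).
  apply: leK; [exact: nnm_EFin|exact: nnmD|] => y /=.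
  rewrite -EFinM -EFinD lee_fin /h mulrA mulVf ?gt_eqF// mul1r.
  by rewrite -lerBlDl le_max lexx.
rewrite addK// kpow_pos_cst scaleK ?invr_ge0 ?(ltW b0)// addeAC [leRHS]addeC leeD2l//.
apply: (@le_trans _ _ ((b^-1)%:E * (\int[mu]_y (h y)%:E + (Rc * rho ^+ t)%:E * V x))).
  by apply: lee_wpmul2l => //; rewrite lee_fin invr_ge0 ltW.
rewrite ge0_muleDr; last 2 first.
- by apply: integral_ge0 => y _; rewrite lee_fin.
- by rewrite mule_ge0 ?V_ge0// lee_fin mulr_ge0 ?exprn_ge0 ?(ltW Rc0) ?(ltW rho0).
apply: leeD; last by rewrite muleA -EFinM mulrC.
have [mhE h0E] := nh.
rewrite -ge0_integralZl ?lee_fin ?invr_ge0 ?(ltW b0)// => [|y _]; last exact: h0E.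
apply: ge0_le_integral => //.
- by move=> y _; exact: nbh.2.
- exact: nbh.1.
- exact/measurable_EFinP.
- by move=> y _; rewrite -EFinM lee_fin ler_pdivrMl.
Qed.

End ErgodicBounds.

(** * Real sequences: variance of sums and Cesaro means along squares *)

Section RealSequences.
Context {R : realType}.

Lemma sum_expr_rev_le (q : R) n : 0 <= q -> q < 1 ->
  \sum_(s < n.+1) q ^+ (n - s) <= (1 - q)^-1.
Proof.
move=> q0 q1; have d0 : 0 < 1 - q by rewrite subr_gt0.
elim: n => [|n IH].
  by rewrite big_ord1 expr0 -[leLHS]invr1 lef_pV2 ?posrE// gerBl.
rewrite big_ord_recr/= subnn expr0.
have -> : \sum_(i < n.+1) q ^+ (n.+1 - i) = q * \sum_(i < n.+1) q ^+ (n - i).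
  by rewrite mulr_sumr; apply: eq_bigr => i _; rewrite subSn ?exprS// -ltnS.
apply: (@le_trans _ _ (q * (1 - q)^-1 + 1)); first by rewrite lerD2r ler_wpM2l.
have -> : q * (1 - q)^-1 + 1 = (1 - q)^-1 * (q + (1 - q)).
  by rewrite mulrDr mulVf ?gt_eqF// [q * _]mulrC.
by rewrite (_ : q + (1 - q) = 1) ?mulr1//; lra.
Qed.

(** Here [y s], [e s t] and [p] stand for the integrals over an event of [Y_s], [Y_s Y_t] and 1. The
    conclusion bounds that of the squared deviation of the sum from [a n], with the negative term
    moved to the right. *)
Lemma variance_sum_bound (e : nat -> nat -> R) (y : nat -> R) (a p D q : R) :
  0 <= a -> 0 <= D -> 0 <= q -> q < 1 ->
  (forall s t, e s t = e t s) ->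
  (forall s r, e s (s + r)%N <= a * y s + D * q ^+ r) ->
  (forall s, a * p <= y s + D * q ^+ s) -> forall n : nat,
  \sum_(s < n) \sum_(t < n) e s t + a ^+ 2 * n%:R ^+ 2 * p <=
  2 * a * n%:R * (\sum_(s < n) y s) + 2 * (1 + a) * D / (1 - q) * n%:R.
Proof.
move=> a0 D0 q0 q1 eC eb yb.
(* The integral of [(Y_s - a) (Y_t - a)]: [eb] controls [e s t - a * y s], and [yb] controls
   [a ^+ 2 * p - a * y t]. *)
pose v s t := e s t - a * y s - a * y t + a ^+ 2 * p.
have vC s t : v s t = v t s by rewrite /v eC; lra.
have vb s t : (s <= t)%N -> v s t <= (1 + a) * D * q ^+ (t - s).
  move=> st; have := eb s (t - s)%N; rewrite subnKC// => h1.
  have h2 := yb t.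
  have qt : q ^+ t <= q ^+ (t - s) by rewrite ler_wiXn2l ?leq_subr// ltW.
  have h3 : a * (a * p) <= a * (y t + D * q ^+ (t - s)).
    rewrite ler_wpM2l//; apply: (le_trans h2); rewrite lerD2l ler_wpM2l//.
  rewrite /v; nra.
have vsum n : \sum_(s < n) \sum_(t < n) v s t <= 2 * ((1 + a) * D / (1 - q)) * n%:R.
  elim: n => [|n IH]; first by rewrite big_ord0 mulr0.
  under eq_bigr do rewrite big_ord_recr/=.
  rewrite big_split/= big_ord_recr/=.
  (* Passing to [n.+1] adds a column containing the diagonal term and a row, each dominated by a
     geometric series. *)
  have row : \sum_(s < n.+1) v s n <= (1 + a) * D / (1 - q).
    apply: (@le_trans _ _ (\sum_(s < n.+1) (1 + a) * D * q ^+ (n - s))).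
      by apply: ler_sum => s _; apply: vb; rewrite -ltnS.
    rewrite -mulr_sumr ler_wpM2l//; last exact: sum_expr_rev_le.
    by rewrite mulr_ge0// addr_ge0.
  have v0 : \sum_(t < n) v n t <= (1 + a) * D / (1 - q).
    apply: (@le_trans _ _ (\sum_(s < n) (1 + a) * D * q ^+ (n - s))).
      by apply: ler_sum => s _; rewrite vC; apply: vb; rewrite ltnW.
    apply: (@le_trans _ _ (\sum_(s < n.+1) (1 + a) * D * q ^+ (n - s))).
      by rewrite big_ord_recr/= lerDl mulr_ge0 ?exprn_ge0// mulr_ge0// addr_ge0.
    rewrite -mulr_sumr ler_wpM2l//; last exact: sum_expr_rev_le.
    by rewrite mulr_ge0// addr_ge0.
  rewrite -[n.+1%:R]natr1 mulrDr mulr1; lra.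
move=> n; have := vsum n.
have -> : \sum_(s < n) \sum_(t < n) v s t =
    \sum_(s < n) \sum_(t < n) e s t - 2 * a * n%:R * (\sum_(s < n) y s)
    + a ^+ 2 * n%:R ^+ 2 * p.
  have sc (x : R) : \sum_(t < n) x = n%:R * x.
    by rewrite sumr_const card_ord mulr_natl.
  transitivity (\sum_(s < n) (\sum_(t < n) e s t - n%:R * a * y s
     - a * (\sum_(t < n) y t) + n%:R * (a ^+ 2 * p))).
    apply: eq_bigr => s _; rewrite !big_split/= !sc sumrN -mulr_sumr.
    by rewrite mulrN (mulrA n%:R a (y s)).
  rewrite !big_split/= !sc !sumrN -mulr_sumr.
  move: (\sum_(s < n) \sum_(t < n) e s t) (\sum_(s < n) y s) (n%:R : R) => E' Y' k.
  by ring.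
have -> : 2 * ((1 + a) * D / (1 - q)) * n%:R = 2 * (1 + a) * D / (1 - q) * n%:R.
  by rewrite !mulrA.
lra.
Qed.

Lemma sqrt_bracket n : exists k, (k ^ 2 <= n < k.+1 ^ 2)%N.
Proof.
elim: n => [|n [k /andP[k1 k2]]]; first by exists 0%N.
have [h|h] := ltnP n.+1 (k.+1 ^ 2)%N.
  by exists k; rewrite h ltnW.
by exists k.+1; rewrite h/= (leq_ltn_trans k2)// ltn_exp2r.
Qed.

(* Monotonicity of the partial sums fills the gaps between consecutive squares. *)
Lemma cesaro_of_squares (U : nat -> R) (a : R) :
  {homo U : n m / (n <= m)%N >-> n <= m} -> (forall n, 0 <= U n) ->
  (U (n.+1 ^ 2)%N / (n.+1%:R ^+ 2)) @[n --> \oo] --> a ->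
  (n%:R^-1 * U n) @[n --> \oo] --> a.
Proof.
move=> ndU U0 Ua.
pose z n := U (n.+1 ^ 2)%N / (n.+1%:R ^+ 2).
(* The ratio of two consecutive squares, which tends to 1. *)
pose r n : R := (1 + n.+1%:R^-1) ^+ 2.
have rE n : r n = n.+2%:R ^+ 2 / n.+1%:R ^+ 2.
  rewrite /r -expr_div_n; congr (_ ^+ 2).
  by rewrite -[n.+2%:R]natr1 mulrDl divff ?pnatr_eq0// mul1r.
have r0 n : 0 < r n by rewrite exprn_gt0// addr_gt0.
have r1 : r n @[n --> \oo] --> (1 : R).
  rewrite -[X in _ --> X](_ : (1 + 0) * (1 + 0) = 1); last by rewrite addr0 mul1r.
  have h : (1 + n.+1%:R^-1 : R) @[n --> \oo] --> (1 + 0 : R).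
    by apply: cvgD; [exact: cvg_cst|exact: cvg_harmonic].
  under eq_fun do rewrite /r expr2; exact: cvgM.
have lo : z n / r n @[n --> \oo] --> a.
  rewrite -[X in _ --> X](_ : a / 1 = a); last by rewrite invr1 mulr1.
  by apply: cvgM => //; apply: cvgV => //; exact: oner_neq0.
have hi : z n.+1 * r n @[n --> \oo] --> a.
  rewrite -[X in _ --> X]mulr1; apply: cvgM => //.
  by rewrite (cvg_shiftS z).
apply/cvgrPdist_lt => e e0.
have /cvgrPdist_lt/(_ _ e0)[n1 _ h1] := lo.
have /cvgrPdist_lt/(_ _ e0)[n2 _ h2] := hi.
exists ((maxn n1 n2).+2 ^ 2)%N => // n /= nn.
(* With [n] between the squares of [k.+1] and [k.+2], the mean [U n / n] lies between [z k / r k]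
   and [z k.+1 * r k]. *)
have [[|k] /andP[k1 k2]] := sqrt_bracket n.
  by move: k2; rewrite exp1n ltnS leqn0 => /eqP n0; move: nn; rewrite n0 leqn0 expn_eq0.
have kn : (maxn n1 n2 <= k)%N.
  have := leq_ltn_trans nn k2; rewrite ltn_exp2r// !ltnS => h; exact: ltnW.
have n0 : (0 < n)%N by apply: leq_trans k1; rewrite expn_gt0.
have n0' : 0 < n%:R :> R by rewrite ltr0n.
have K1 : (k.+1%:R ^+ 2 : R) <= n%:R by rewrite -natrX ler_nat.
have K2 : n%:R <= (k.+2%:R ^+ 2 : R) by rewrite -natrX ler_nat ltnW.
have L : z k / r k <= n%:R^-1 * U n.
  rewrite /z rE invf_div mulrA divfK ?expf_neq0 ?pnatr_eq0// mulrC.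
  by apply: ler_pM; rewrite ?invr_ge0 ?exprn_ge0 ?U0// ?lef_pV2 ?posrE ?exprn_gt0 ?ndU.
have H : n%:R^-1 * U n <= z k.+1 * r k.
  rewrite /z rE mulrA divfK ?expf_neq0 ?pnatr_eq0// mulrC.
  apply: ler_pM; rewrite ?invr_ge0 ?U0 ?(ltW n0')//; first by apply: ndU; exact: ltnW.
  by rewrite lef_pV2 ?posrE ?exprn_gt0.
have := h1 k (leq_trans (leq_maxl _ _) kn); have := h2 k (leq_trans (leq_maxr _ _) kn).
rewrite !ltr_norml => /andP[A1 A2] /andP[A3 A4]; apply/andP; split; lra.
Qed.

(** Telescoping: the inverse square of [m + 2] is at most [1 / (m + 1) - 1 / (m + 2)]. *)
Lemma sum_inv_sqr_le n : \sum_(k < n) (k.+1%:R ^+ 2)^-1 <= 2 :> R.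
Proof.
suff h m : \sum_(k < m.+1) (k.+1%:R ^+ 2)^-1 <= 2 - m.+1%:R^-1 :> R.
  case: n => [|n]; first by rewrite big_ord0.
  by apply: (le_trans (h n)); rewrite gerBl invr_ge0.
elim: m => [|m IH]; first by rewrite big_ord1 expr1n invr1; lra.
rewrite big_ord_recr/=.
suff h : (m.+2%:R ^+ 2)^-1 <= m.+1%:R^-1 - m.+2%:R^-1 :> R.
  by apply: (le_trans (lerD IH h)); rewrite addrA subrK.
have -> : m.+1%:R^-1 - m.+2%:R^-1 = (m.+1%:R * m.+2%:R)^-1 :> R.
  have m1 : m.+1%:R != 0 :> R by rewrite pnatr_eq0.
  have m2 : m.+2%:R != 0 :> R by rewrite pnatr_eq0.
  move: m1 m2; rewrite -[m.+2%:R]natr1; move: (m.+1%:R : R) => x x0 x1.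
  by field; rewrite x0 x1.
by rewrite lef_pV2 ?posrE ?exprn_gt0 ?mulr_gt0// expr2 ler_wpM2r// ler_nat.
Qed.

End RealSequences.

(** * The law of large numbers *)

Section LawOfLargeNumbers.
Local Open Scope ereal_scope.
Context {R : realType}
  {dO} {Om : measurableType dO} {P : probability Om R}
  {dX} {X : measurableType dX} {K : R.-pker X ~> X} {mu0 : probability X R}
  {N0 : nat} {N : nat -> Om -> nat}
  {xi : nat -> nat -> Om -> X} {w : nat -> nat -> Om -> R}
  {C : nat -> nat -> Om -> R} {M : nat -> nat -> Om -> nat}
  {xih : nat -> nat -> Om -> X} {wh : nat -> nat -> Om -> R}
  {F Fh : nat -> set (set Om)}
  (spl : splitting_method P K mu0 N0 N xi w C M xih wh F Fh)
  (mass1 : {ae P, forall u, forall t, mass (N := N) (w := w) t u = 1%R}).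

Local Notation m t := (psum (N t) (w t) (xi t)).

Definition particle_sum (f : X -> R) t u : R :=
  (\sum_(i < N t u) w t i u * f (xi t i u))%R.

Lemma particle_sumE f t u : (particle_sum f t u)%:E = m t (EFin \o f) u.
Proof. by rewrite /particle_sum -sumEFin. Qed.

Context (V : X -> \bar R) (nV : nnm V) (V1 : forall x, 1 <= V x).
Context (a Rc rho CV : R) (a0 : (0 <= a)%R) (Rc0 : (0 < Rc)%R)
  (rho0 : (0 < rho)%R) (rho1 : (rho < 1)%R) (CV0 : (0 <= CV)%R).
Context (KV : forall t x, kpow_pos K t V x <= CV%:E * V x).
Context (f : X -> R) (mf : measurable_fun setT f) (f0 : (forall x, 0 <= f x)%R).
Context (f_affine : forall (c : R) x, (0 < c)%R ->
  (f x)%:E <= c%:E + (c^-1)%:E * V x).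
Context (Kf_ge : forall t x,
  a%:E <= kpow_pos K t (EFin \o f) x + (Rc * rho ^+ t)%:E * V x).
Context (Kf_le : forall t x (b : R), (0 < b)%R ->
  kpow_pos K t (EFin \o f) x <= a%:E + b%:E + (Rc * rho ^+ t / b)%:E * V x).

(** At a level [b] proportional to [q ^+ r], both [b] and [rho ^+ r / b] in [Kf_le] decay like
    [q ^+ r]. *)
Let q := Num.sqrt rho.
Let Y := particle_sum f.

Let nnm_real {e} {T : measurableType e} (c : R) :
  (0 <= c)%R -> nnm (fun _ : T => c%:E).
Proof. by move=> c0; apply: nnm_cst; rewrite lee_fin. Qed.

Let nf : nnm (EFin \o f). Proof. exact: nnm_EFin. Qed.

Let nKf t : nnm (kpow_pos K t (EFin \o f)).
Proof. by have [nK _ _ _ _] := kern_op_kpow K t; exact: nK. Qed.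

Let nm t h : nnm h -> nnm (m t h : Om -> \bar R).
Proof.
by move=> nh; apply: (sub_sigma_nnm _ _ (split_sigmaF spl t)); exact: (nnm_split spl t).
Qed.

Let q0 : (0 < q)%R. Proof. by rewrite sqrtr_gt0. Qed.
Let q1 : (q < 1)%R. Proof. by rewrite -sqrtr1 ltr_sqrt. Qed.
Let qq t : (rho ^+ t = q ^+ t * q ^+ t)%R.
Proof. by rewrite -exprMn -expr2 sqr_sqrtr// ltW. Qed.

Lemma psum_le t (g h : X -> \bar R) u : nnm g -> nnm h ->
  (forall x, g x <= h x) -> m t g u <= m t h u.
Proof. by have [_ leK _ _ _] := kern_op_split spl t; move=> *; exact: leK. Qed.

Lemma psum_affine t u (al be : R) : (0 <= al)%R -> (0 <= be)%R ->
  m t (fun x => al%:E + be%:E * V x) u = (al * mass (N := N) (w := w) t u)%:E + be%:E * m t V u.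
Proof.
move=> al0 be0; have [_ _ addK scaleK _] := kern_op_split spl t.
have n1 : nnm (fun _ : X => 1 : \bar R) by exact: nnm_cst.
have nbe : nnm (fun x => be%:E * V x) by apply: nnmM => //; exact: nnm_real.
rewrite (addK _ _ (nnm_real _ al0) nbe).
rewrite (scaleK _ _ be0 nV) EFinM (massE (xi := xi)) -(scaleK _ _ al0 n1); congr (m t _ u + _).
by apply/funext => x; rewrite mule1.
Qed.

Lemma nnm_affine (al be : R) : (0 <= al)%R -> (0 <= be)%R ->
  nnm (fun x => al%:E + be%:E * V x).
Proof.
by move=> *; apply: nnmD; [exact: nnm_real|apply: nnmM => //; exact: nnm_real].
Qed.

(* With z = m_s(V) and c = sqrt z, the affine majorants of f and K^r f at the
   levels c and q^r c turn m_s(f) m_s(K^r f) - a m_s(f) into O(q^r z). *)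
Lemma covariance_bound s r u : mass (N := N) (w := w) s u = 1%R ->
  m s (EFin \o f) u * m s (kpow_pos K r (EFin \o f)) u <=
  a%:E * m s (EFin \o f) u + (2 * (1 + Rc) * q ^+ r)%:E * m s V u.
Proof.
move=> S1.
have Q0 : (0 < q ^+ r)%R by rewrite exprn_gt0.
have Y0 : (0 <= Y s u)%R by rewrite -lee_fin particle_sumE; exact: (nm s _ nf).2.
have z1 : 1 <= m s V u.
  have -> : 1 = (mass (N := N) (w := w) s u)%:E by rewrite S1.
  rewrite (massE (xi := xi)).
  by apply: psum_le => //; exact: nnm_cst.
rewrite -particle_sumE.
(* If [m s V u] is infinite, so is the right-hand side. *)
case Ez : (m s V u) z1 => [z||//]; last first.
  move=> _; rewrite gt0_muley ?lte_fin ?mulr_gt0 ?addr_gt0//.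
  by rewrite -EFinM addey ?leey.
rewrite lee_fin => z1; have z0 : (0 < z)%R by apply: lt_le_trans z1.
pose c := Num.sqrt z.
have c0 : (0 < c)%R by rewrite sqrtr_gt0.
have zE : z = (c * c)%R by rewrite -expr2 sqr_sqrtr// ltW.
(* By unit mass the affine majorant integrates to [c + z / c = 2 c]. *)
have Yc : (Y s u <= 2 * c)%R.
  have : m s (EFin \o f) u <= m s (fun x => c%:E + (c^-1)%:E * V x) u.
    apply: psum_le => // [|x]; last exact: f_affine.
    by apply: nnm_affine; rewrite ?invr_ge0 ltW.
  rewrite psum_affine ?invr_ge0 ?(ltW c0)// S1 mulr1 Ez -particle_sumE.
  rewrite -EFinM -EFinD lee_fin zE mulKf ?gt_eqF//; rewrite /Y; lra.
pose b := (q ^+ r * c)%R.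
have b0 : (0 < b)%R by rewrite mulr_gt0.
have be0 : (0 <= Rc * rho ^+ r / b)%R.
  by rewrite divr_ge0 ?(ltW b0)// mulr_ge0 ?exprn_ge0// ltW.
(* As [rho = q ^+ 2] and [z = c ^+ 2], the two error terms at level [b] are [q ^+ r * c] and
   [Rc * q ^+ r * c]. *)
have W : m s (kpow_pos K r (EFin \o f)) u <= (a + (1 + Rc) * q ^+ r * c)%:E.
  have : m s (kpow_pos K r (EFin \o f)) u <=
      m s (fun x => (a + b)%:E + (Rc * rho ^+ r / b)%:E * V x) u.
    apply: psum_le => // [|x]; last by rewrite EFinD; exact: Kf_le.
    by apply: nnm_affine => //; rewrite addr_ge0// ltW.
  rewrite psum_affine ?addr_ge0 ?(ltW b0)// S1 mulr1 Ez -EFinM -EFinD.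
  move=> /le_trans; apply; rewrite lee_fin zE qq /b le_eqVlt; apply/orP; left; apply/eqP.
  by field; rewrite !gt_eqF.
apply: (@le_trans _ _ ((Y s u)%:E * (a + (1 + Rc) * q ^+ r * c)%:E)).
  by apply: lee_wpmul2l => //; rewrite lee_fin.
rewrite -!EFinM -EFinD lee_fin mulrDr [(Y s u * a)%R]mulrC lerD2l.
apply: (@le_trans _ _ (2 * c * ((1 + Rc) * q ^+ r * c))%R).
  by rewrite ler_wpM2r// !mulr_ge0 ?addr_ge0// ltW.
by rewrite zE le_eqVlt; apply/orP; left; apply/eqP; ring.
Qed.

(** * Moment bounds on an initial event where m_0(V) is bounded *)

Section Localized.
Context (A : set Om) (L : R) (FA : F 0 A) (L0 : (0 <= L)%R).
Context (VA : forall u, A u -> m 0 V u <= L%:E).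

Let mA : measurable A. Proof. exact: (split_sigmaF spl 0).2. Qed.

Let FsA s : F s A. Proof. exact: (split_F_mono spl _ _ (leq0n s)). Qed.

Lemma integral_psum0 s h : nnm h ->
  \int[P]_(u in A) m s h u = \int[P]_(u in A) m 0 (kpow_pos K s h) u.
Proof. by move=> nh; have := particle_cond spl 0 s h nh A FA; rewrite add0n. Qed.

Lemma integral_psum_le s h (c : R) : (0 <= c)%R -> nnm h ->
  (forall u, A u -> m 0 (kpow_pos K s h) u <= c%:E) ->
  \int[P]_(u in A) m s h u <= c%:E.
Proof.
move=> c0 nh hc; rewrite integral_psum0//.
have nKh : nnm (kpow_pos K s h) by have [nK _ _ _ _] := kern_op_kpow K s; exact: nK.
apply: (@le_trans _ _ (\int[P]_(u in A) c%:E)).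
  apply: ge0_le_integral => //.
  - by move=> u _; exact: (nm 0 _ nKh).2.
  - exact: measurable_funTS (nm 0 _ nKh).1.
rewrite integral_cst// -[leRHS]mule1 lee_wpmul2l ?lee_fin//; exact: probability_le1.
Qed.

Lemma integral_V_le s : \int[P]_(u in A) m s V u <= (CV * L)%:E.
Proof.
apply: integral_psum_le => //; first exact: mulr_ge0.
move=> u Au; apply: (@le_trans _ _ (m 0 (fun x => 0%:E + CV%:E * V x) u)).
  apply: psum_le => [||x]; last by rewrite add0e.
    by have [nK _ _ _ _] := kern_op_kpow K s; exact: nK.
  exact: nnm_affine.
by rewrite psum_affine// mul0r add0e EFinM lee_wpmul2l ?VA// lee_fin.
Qed.

Let y s := fine (\int[P]_(u in A) (Y s u)%:E).

Let yE s : \int[P]_(u in A) (Y s u)%:E = (y s)%:E.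
Proof.
rewrite /y fineK// ge0_fin_numE; last first.
  by apply: integral_ge0 => u _; rewrite particle_sumE; exact: (nm s _ nf).2.
under eq_integral do rewrite particle_sumE.
(* [Kf_le] at level 1, integrated against m_0, whose mass is 1. *)
apply: (@le_lt_trans _ _ (a + 1 + Rc * rho ^+ s * L)%:E); last exact: ltry.
have be0 : (0 <= Rc * rho ^+ s)%R by rewrite mulr_ge0 ?exprn_ge0// ltW.
apply: integral_psum_le => //; first by rewrite !addr_ge0// mulr_ge0.
move=> u Au; apply: (@le_trans _ _ (m 0 (fun x => (a + 1)%:E + (Rc * rho ^+ s)%:E * V x) u)).
  apply: psum_le => // [|x]; first by apply: nnm_affine => //; rewrite addr_ge0.
  by have := Kf_le s x 1 ltr01; rewrite divr1 EFinD.
rewrite psum_affine ?addr_ge0// (mass0 spl) mulr1 [leRHS]EFinD leeD2l//.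
by rewrite [leRHS]EFinM lee_wpmul2l ?VA// lee_fin.
Qed.

Let p := fine (P A).
Let pE : P A = p%:E. Proof. by rewrite /p fineK// fin_num_measure. Qed.

(** [Kf_ge] is integrated against m_0. The rate [rho ^+ s] is weakened to [q ^+ s] to match the
    second-moment bound. *)
Lemma mean_ge s : (a * p <= y s + Rc * L * q ^+ s)%R.
Proof.
have be0 : (0 <= Rc * rho ^+ s)%R by rewrite mulr_ge0 ?exprn_ge0// ltW.
have c0 : (0 <= Rc * rho ^+ s * L)%R by rewrite mulr_ge0.
have pt u : A u -> a%:E <= m 0 (kpow_pos K s (EFin \o f)) u + (Rc * rho ^+ s * L)%:E.
  move=> Au.
  have nVr : nnm (fun x => (Rc * rho ^+ s)%:E * V x).
    by apply: nnmM => //; exact: nnm_real.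
  apply: (@le_trans _ _ (m 0 (fun x => kpow_pos K s (EFin \o f) x + (Rc * rho ^+ s)%:E * V x) u)).
    apply: (@le_trans _ _ (m 0 (fun x => a%:E + 0%:E * V x) u)).
      by rewrite psum_affine// (mass0 spl) mulr1 mul0e adde0.
    apply: psum_le => [||x]; [exact: nnm_affine|exact: nnmD|].
    by rewrite mul0e adde0.
  have [_ _ addK scaleK _] := kern_op_split spl 0.
  by rewrite addK// scaleK// leeD2l// [leRHS]EFinM lee_wpmul2l ?VA// lee_fin.
have : (a * p)%:E <= (y s + Rc * rho ^+ s * L * p)%:E.
  have ic (c : R) : (c * p)%:E = \int[P]_(u in A) c%:E.
    by rewrite EFinM -pE -(integral_cst P mA).
  rewrite EFinD -yE !ic.
  under [X in _ <= X + _]eq_integral do rewrite particle_sumE.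
  rewrite integral_psum0// -ge0_integralD//; last 2 first.
  - by move=> u _; exact: (nm 0 _ (nKf s)).2.
  - exact: measurable_funTS (nm 0 _ (nKf s)).1.
  apply: ge0_le_integral => //.
  apply: emeasurable_funD => //; exact: measurable_funTS (nm 0 _ (nKf s)).1.
rewrite lee_fin => /le_trans; apply; rewrite lerD2l.
have p1 : (p <= 1)%R by rewrite -lee_fin -pE; exact: probability_le1.
apply: (@le_trans _ _ (Rc * rho ^+ s * L)%R); first by rewrite ler_piMr.
rewrite -mulrA [(_ * L)%R]mulrC mulrA ler_wpM2l ?mulr_ge0 ?(ltW Rc0)// qq.
by rewrite ler_piMr ?exprn_ge0 ?exprn_ile1 ?(ltW q0) ?(ltW q1).
Qed.

Let e s t := fine (\int[P]_(u in A) (Y s u * Y t u)%:E).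

Let nY t : nnm (fun u => (Y t u)%:E : \bar R).
Proof. by under eq_fun do rewrite particle_sumE; exact: nm. Qed.

(** [Y s] is [F s]-measurable, so conditioning replaces the later sum by m_s(K^r f). The pathwise
    [covariance_bound] is then integrated, and [integral_V_le] bounds the contribution of V
    uniformly in [s]. *)
Lemma second_moment_le s r :
  \int[P]_(u in A) (Y s u * Y (s + r)%N u)%:E <=
  (a * y s + 2 * (1 + Rc) * (CV * L) * q ^+ r)%:E.
Proof.
have mf' h : nnm h -> measurable_fun A (h : Om -> \bar R).
  by move=> nh; exact: measurable_funTS nh.1.
under eq_integral do rewrite EFinM !particle_sumE.
have := cond_eqM P _ _ _ _ (split_sigmaF spl s) (nm _ _ nf) (nm _ _ (nKf r))
  (particle_cond spl s r _ nf) (nnm_split spl s _ nf) _ (FsA s).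
move=> ->.
have D0 : (0 <= 2 * (1 + Rc) * q ^+ r)%R.
  by rewrite !mulr_ge0 ?addr_ge0 ?exprn_ge0// ltW.
have nR1 : nnm (fun u : Om => a%:E * m s (EFin \o f) u).
  by apply: nnmM; [exact: nnm_real|exact: nm].
have nR2 : nnm (fun u : Om => (2 * (1 + Rc) * q ^+ r)%:E * m s V u).
  by apply: nnmM; [exact: nnm_real|exact: nm].
apply: (@le_trans _ _ (\int[P]_(u in A)
    (a%:E * m s (EFin \o f) u + (2 * (1 + Rc) * q ^+ r)%:E * m s V u))).
  apply: ae_ge0_le_integral => //.
  - by move=> u _; apply: mule_ge0; [exact: (nm s _ nf).2|exact: (nm s _ (nKf r)).2].
  - by apply: mf'; apply: nnmM; exact: nm.
  - by move=> u _; exact: (nnmD _ _ nR1 nR2).2.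
  - by apply: mf'; exact: nnmD.
  - by apply: filterS mass1 => u S1 _; exact: covariance_bound.
rewrite ge0_integralD//; last 4 first.
- by move=> u _; exact: nR1.2.
- exact: mf'.
- by move=> u _; exact: nR2.2.
- exact: mf'.
rewrite ge0_integralZl//; last 2 first.
- by apply: mf'; exact: nm.
- by move=> u _; exact: (nm s _ nf).2.
rewrite ge0_integralZl ?lee_fin//; last 2 first.
- by apply: mf'; exact: nm.
- by move=> u _; exact: (nm s _ nV).2.
under eq_integral do rewrite -particle_sumE.
rewrite yE EFinD EFinM leeD2l// [leRHS](_ : _ = (2 * (1 + Rc) * q ^+ r)%:E * (CV * L)%:E).
  by rewrite lee_wpmul2l ?lee_fin// integral_V_le.
by rewrite -EFinM; congr (_%:E); ring.
Qed.

Lemma squared_deviation_le : exists B : R, (0 <= B)%R /\ forall n : nat,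
  \int[P]_(u in A) (((\sum_(t < n) Y t u) - a * n%:R) ^+ 2)%:E <= (B * n%:R)%:E.
Proof.
(* One constant serves both the second moments and the means. *)
pose D := (2 * (1 + Rc) * (CV * L) + Rc * L)%R.
have D1 : (0 <= 2 * (1 + Rc) * (CV * L))%R by rewrite !mulr_ge0 ?addr_ge0// ltW.
have D2 : (0 <= Rc * L)%R by rewrite mulr_ge0// ltW.
have D0 : (0 <= D)%R by exact: addr_ge0.
exists (2 * (1 + a) * D / (1 - q))%R; split.
  by rewrite divr_ge0 ?subr_ge0 ?(ltW q1)// !mulr_ge0 ?addr_ge0.
move=> n.
have nYY s t : nnm (fun u : Om => (Y s u * Y t u)%:E : \bar R).
  by under eq_fun do rewrite EFinM; apply: nnmM.
have eE s t : \int[P]_(u in A) (Y s u * Y t u)%:E = (e s t)%:E.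
  wlog st : s t / (s <= t)%N => [h|].
    have [/h//|/ltnW /h] := leqP s t.
    by rewrite /e; under eq_integral do rewrite mulrC.
  rewrite /e fineK// ge0_fin_numE; last by apply: integral_ge0 => u _; exact: (nYY s t).2.
  by rewrite -(subnKC st) (le_lt_trans (second_moment_le _ _))// ltry.
have eC s t : e s t = e t s.
  by rewrite /e; congr fine; apply: eq_integral => u _; rewrite mulrC.
have eb s r : (e s (s + r)%N <= a * y s + D * q ^+ r)%R.
  rewrite -lee_fin -eE (le_trans (second_moment_le _ _))// lee_fin lerD2l.
  by rewrite ler_wpM2r ?exprn_ge0 ?(ltW q0)// lerDl.
have yb s : (a * p <= y s + D * q ^+ s)%R.
  rewrite (le_trans (mean_ge s))// lerD2l.
  by rewrite ler_wpM2r ?exprn_ge0 ?(ltW q0)// lerDr.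
have := variance_sum_bound e y a p D q a0 D0 (ltW q0) q1 eC eb yb n.
pose W u := (\sum_(t < n) Y t u)%R.
have Y0 t u : (0 <= Y t u)%R by rewrite -lee_fin; exact: (nY t).2.
have W0 u : (0 <= W u)%R by exact: sumr_ge0.
have mY t : measurable_fun setT (Y t) by apply/measurable_EFinP; exact: (nY t).1.
have mW : measurable_fun setT W by exact: measurable_sum.
have IW : \int[P]_(u in A) (W u)%:E = (\sum_(t < n) y t)%:E.
  rewrite -sumEFin; under eq_integral do rewrite -sumEFin.
  rewrite ge0_integral_sum//.
  - by apply: eq_bigr => t _; exact: yE.
  - by move=> t; exact: measurable_funTS (nY t).1.
  - by move=> t u _; exact: (nY t).2.
have IW2 : \int[P]_(u in A) (W u ^+ 2)%:E = (\sum_(s < n) \sum_(t < n) e s t)%:E.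
  rewrite -sumEFin.
  transitivity (\int[P]_(u in A) \sum_(s < n) \sum_(t < n) (Y s u * Y t u)%:E).
    apply: eq_integral => u _; rewrite expr2 /W big_distrlr/= -sumEFin.
    by apply: eq_bigr => s _; rewrite -sumEFin.
  have nS s : nnm (fun u => \sum_(t < n) (Y s u * Y t u)%:E).
    exact: (nnm_sum (fun t u => (Y s u * Y t u)%:E)).
  rewrite (ge0_integral_sum _ _ (f := fun (s : 'I_n) (u : Om) => \sum_(t < n) (Y s u * Y t u)%:E))//.
  - apply: eq_bigr => s _; rewrite ge0_integral_sum//.
    + by rewrite -sumEFin; apply: eq_bigr => t _; exact: eE.
    + by move=> t; exact: measurable_funTS (nYY s t).1.
    + by move=> t u _; exact: (nYY s t).2.
  - by move=> s; exact: measurable_funTS (nS s).1.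
  - by move=> s u _; exact: (nS s).2.
have ic (c : R) : \int[P]_(u in A) c%:E = (c * p)%:E.
  by rewrite integral_cst// EFinM -pE.
have c0 : (0 <= 2 * a * n%:R)%R by rewrite !mulr_ge0.
(* The expanded square, its negative term moved to the left so that all integrands are
   nonnegative. *)
have EQ : \int[P]_(u in A) ((W u - a * n%:R) ^+ 2)%:E
    + (2 * a * n%:R * (\sum_(t < n) y t))%:E
    = (\sum_(s < n) \sum_(t < n) e s t + a ^+ 2 * n%:R ^+ 2 * p)%:E.
  rewrite EFinM -IW -ge0_integralZl ?lee_fin//; last 2 first.
  - by apply: measurable_funTS; exact/measurable_EFinP.
  - by move=> u _; rewrite lee_fin.
  rewrite EFinD -ic -IW2 -!ge0_integralD//.
  - by apply: eq_integral => u _; rewrite -EFinM -!EFinD; congr (_%:E); ring.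
  - by move=> u _; rewrite lee_fin sqr_ge0.
  - by apply: measurable_funTS; apply/measurable_EFinP; exact: measurable_funX.
  - by move=> u _; rewrite lee_fin mulr_ge0 ?sqr_ge0.
  - by move=> u _; rewrite lee_fin sqr_ge0.
  - apply: measurable_funTS; apply/measurable_EFinP; apply: measurable_funX.
    exact: measurable_funB.
  - by move=> u _; rewrite -EFinM lee_fin mulr_ge0.
  - apply: measurable_funTS; apply/measurable_EFinP.
    by apply: measurable_funM.
move: EQ; move: (\int[P]_(u in A) _) => [J||]//.
rewrite -!EFinD => -[EQ] H; rewrite lee_fin -(lerD2r (2 * a * n%:R * (\sum_(t < n) y t))) EQ.
by rewrite [leRHS]addrC.
Qed.

(** Along the squares, the squared deviation of the mean has integral at most [B / k n], which is
    summable. Their series is thus finite almost everywhere on [A], and its terms tend to 0. *)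
Lemma lln_on : {ae P, forall u, A u ->
  (n%:R^-1 * (\sum_(t < n) Y t u))%R @[n --> \oo] --> a}.
Proof.
have [B [B0 dev]] := squared_deviation_le.
have Y0 t u : (0 <= Y t u)%R by rewrite -lee_fin; exact: (nY t).2.
have mY t : measurable_fun setT (Y t) by apply/measurable_EFinP; exact: (nY t).1.
pose W n u := (\sum_(t < n) Y t u)%R.
pose k n : R := (n.+1%:R ^+ 2)%R.
have k0 n : (0 < k n)%R by rewrite exprn_gt0.
pose Z n u := ((W (n.+1 ^ 2)%N u / k n - a) ^+ 2)%R.
have Z0 n u : 0 <= (Z n u)%:E by rewrite lee_fin sqr_ge0.
have mZ n : measurable_fun A (fun u => (Z n u)%:E).
  apply: measurable_funTS; apply/measurable_EFinP; apply: measurable_funX.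
  apply: measurable_funB => //; apply: measurable_funM => //.
  exact: measurable_sum.
have IZ n : \int[P]_(u in A) (Z n u)%:E <= (B * (k n)^-1)%:E.
  have -> : \int[P]_(u in A) (Z n u)%:E =
      ((k n)^-1 ^+ 2)%:E * \int[P]_(u in A) ((W (n.+1 ^ 2)%N u - a * (n.+1 ^ 2)%:R) ^+ 2)%:E.
    rewrite -ge0_integralZl ?lee_fin ?sqr_ge0//.
    - apply: eq_integral => u _; rewrite -EFinM -exprMn; congr ((_ ^+ 2)%:E).
      by rewrite natrX -/(k n) mulrBr mulrC [in RHS]mulrC mulrC [(_^-1 * _)%R]mulrC mulfK// gt_eqF.
    - apply: measurable_funTS; apply/measurable_EFinP; apply: measurable_funX.
      by apply: measurable_funB => //; exact: measurable_sum.
    - by move=> u _; rewrite lee_fin sqr_ge0.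
  apply: (@le_trans _ _ (((k n)^-1 ^+ 2)%:E * (B * (n.+1 ^ 2)%:R)%:E)).
    by apply: lee_wpmul2l; [rewrite lee_fin sqr_ge0|exact: dev].
  rewrite -EFinM lee_fin natrX -/(k n) le_eqVlt; apply/orP; left; apply/eqP.
  by field; rewrite gt_eqF.
have IS : \int[P]_(u in A) (\sum_(n <oo) (Z n u)%:E) < +oo.
  rewrite integral_nneseries//.
  apply: (@le_lt_trans _ _ (B * 2)%:E); last exact: ltry.
  apply: lime_le.
    by apply: is_cvg_nneseries => n _ _; apply: integral_ge0.
  apply: nearW => n; rewrite big_mkord.
  apply: (@le_trans _ _ (\sum_(i < n) (B * (k i)^-1)%:E)).
    by apply: lee_sum => i _; exact: IZ.
  by rewrite sumEFin lee_fin -mulr_sumr ler_wpM2l// sum_inv_sqr_le.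
have intS : P.-integrable A (fun u => \sum_(n <oo) (Z n u)%:E).
  apply/integrableP; split; first exact: ge0_emeasurable_sum.
  under eq_integral => u _ do rewrite gee0_abs ?nneseries_ge0//.
  exact: IS.
apply: filterS (integrable_ae mA intS) => u fS Au.
have Slt : \sum_(n <oo) (Z n u)%:E < +oo.
  by rewrite -ge0_fin_numE ?fS//; apply: nneseries_ge0.
have Zc : (Z n u)%:E @[n --> \oo] --> 0.
  apply: (squeeze_cvge (f := fun=> 0) (h := fun n => \sum_(n <= i <oo) (Z i u)%:E)).
  - apply: nearW => n; rewrite Z0/=.
    apply: (le_trans _ (nneseries_lim_ge n.+1 _)); last by move=> *; exact: Z0.
    by rewrite big_nat1.
  - exact: cvg_cst.
  - exact: nneseries_tail_cvg.
have Wc : (W (n.+1 ^ 2)%N u / k n)%R @[n --> \oo] --> a.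
  apply/cvgrPdist_lt => eps eps0.
  have e20 : (0 < eps ^+ 2)%R by rewrite exprn_gt0.
  have /fine_cvgP[_ /cvgrPdist_lt/(_ _ e20)[n0 _ hn0]] := Zc.
  exists n0 => // n /hn0 /=; rewrite sub0r normrN ger0_norm ?sqr_ge0// => h.
  rewrite distrC -(@ltr_pXn2r _ 2)// ?nnegrE ?(ltW eps0)//.
  by rewrite real_normK ?num_real.
apply: (cesaro_of_squares (fun n => W n u)) => //.
- move=> i j ij; rewrite /W -(subnKC ij) big_split_ord/= lerDl.
  exact: sumr_ge0.
- by move=> n; exact: sumr_ge0.
Qed.

End Localized.
End LawOfLargeNumbers.

(** Thresholds [1 / (k + 1)] make the event a countable combination. Its measurability lets
    probability one be read as an almost everywhere statement. *)
Lemma measurable_cvg_set {R : realType} {d} {T : measurableType d}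
    (Y : nat -> T -> R) (a : R) : (forall n, measurable_fun setT (Y n)) ->
  measurable [set x | Y n x @[n --> \oo] --> a].
Proof.
move=> mY.
have -> : [set x | Y n x @[n --> \oo] --> a] =
    \bigcap_k \bigcup_N \bigcap_(n in [set n | (N <= n)%N])
      [set x | `|a - Y n x| < k.+1%:R^-1].
  apply/seteqP; split=> x /=.
    move=> /cvgrPdist_lt Yx k _.
    by have [|N _ hN] := Yx k.+1%:R^-1; [rewrite invr_gt0|exists N].
  move=> h; apply/cvgrPdist_lt => e e0.
  have [N _ hN] := h (Num.truncn e^-1) I.
  exists N => // n /= /hN /lt_le_trans; apply.
  by rewrite invf_ple ?posrE// ltW// truncnS_gt.
apply: bigcap_measurable => // k _; apply: bigcup_measurable => N _.
apply: bigcap_measurable => [|n _]; first by exists N => /=.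
apply: measurable_ltr; apply: measurableT_comp => //.
exact: measurable_funB.
Qed.

(** * The strong law under unit mass, without localization *)

Section StrongLaw.
Context {R : realType}
  {dO} {Om : measurableType dO} {P : probability Om R}
  {dX} {X : measurableType dX} {K : R.-pker X ~> X} {mu0 : probability X R}
  {N0 : nat} {N : nat -> Om -> nat}
  {xi : nat -> nat -> Om -> X} {w : nat -> nat -> Om -> R}
  {C : nat -> nat -> Om -> R} {M : nat -> nat -> Om -> nat}
  {xih : nat -> nat -> Om -> X} {wh : nat -> nat -> Om -> R}
  {F Fh : nat -> set (set Om)}
  (spl : splitting_method P K mu0 N0 N xi w C M xih wh F Fh).

Local Notation m t := (psum (N t) (w t) (xi t)).
Local Notation Y := (particle_sum (N := N) (xi := xi) (w := w)).

Lemma measurable_particle_sum f t : measurable_fun setT f ->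
  measurable_fun setT (Y f t).
Proof.
move=> mf.
have mg (g : X -> R) : measurable_fun setT g -> (forall x, 0 <= g x) ->
    measurable_fun setT (Y g t).
  move=> mg g0; apply/measurable_EFinP.
  have [+ _] := sub_sigma_nnm _ _ (split_sigmaF spl t)
    (nnm_split spl t _ (nnm_EFin _ mg g0)).
  by apply: eq_measurable_fun => u _ /=; rewrite particle_sumE.
(* The operator results cover nonnegative functions, so a signed [f] is split. *)
have -> : Y f t = fun u => Y (fun x => Num.max (f x) 0) t u
                         - Y (fun x => Num.max (- f x) 0) t u.
  apply/funext => u; rewrite /particle_sum -sumrB; apply: eq_bigr => i _.
  rewrite -mulrBr; congr (_ * _); move: (f _) => r.
  have [r0|r0] := leP r 0; [rewrite max_l ?oppr_ge0// sub0r opprK//|].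
  by rewrite max_r ?subr0// oppr_le0 ltW.
apply: measurable_funB; apply: mg.
- exact: measurable_maxr.
- by move=> x; rewrite le_max lexx orbT.
- by apply: measurable_maxr => //; exact: measurableT_comp.
- by move=> x; rewrite le_max lexx orbT.
Qed.

Definition particle_mean f T u : R := T%:R^-1 * (\sum_(t < T) Y f t u).

Lemma measurable_particle_mean f T : measurable_fun setT f ->
  measurable_fun setT (particle_mean f T).
Proof.
move=> mf; apply: measurable_funM => //; apply: measurable_sum => t.
exact: measurable_particle_sum.
Qed.

Context {mu : probability X R} {V : X -> \bar R}.
Context (erg : V_uniformly_ergodic K mu V)
  (muV : mu0 [set x | (V x < +oo)%E] = 1%E)
  (mass1 : {ae P, forall u, forall t, mass (N := N) (w := w) t u = 1}).

(** The product formula with every [B i] equal to the set where V is finite places all [N0] initial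
    particles there. *)
Lemma initial_V_lt_pinfty : {ae P, forall u, (m 0 V u < +oo)%E}.
Proof.
have [_ _ [mV V1] _ _] := erg.
have V0 x : (0 <= V x)%E by exact: V_ge0.
pose B := [set x | (V x < +oo)%E].
have mB : measurable B.
  by rewrite -[B]setTI; exact: emeasurable_fun_infty_o.
have [_ [N0p NE _ init] _ _] := spl.
have PE : P [set u | forall i, (i < N0)%N -> B (xi 0 i u)] = 1%E.
  rewrite (init (fun=> B))//.
  by rewrite big1// => i _; rewrite muV.
have mE : measurable [set u | forall i, (i < N0)%N -> B (xi 0 i u)].
  rewrite (_ : [set u | _] = \bigcap_(i in [set i | (i < N0)%N]) (xi 0 i @^-1` B)); last first.
    by apply/seteqP; split.
  apply: bigcap_measurable => [|i /= iN]; first by exists 0%N.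
  have [mN mx _ _] := split_meas spl 0 i.
  have := sub_sigma_meas_fun _ _ _ (split_sigmaF spl 0) mN mx.
  have DT : [set u | (i < N 0 u)%N] = setT.
    by apply/seteqP; split => u //= _; rewrite NE.
  by rewrite DT -[_ @^-1` _]setTI; exact.
have /(prob1_ae _ _ mE) := PE; apply: filterS => u /= uB.
apply: lte_sum_pinfty => i _.
have iN : (i < N0)%N by rewrite -(NE u).
apply: lte_mul_pinfty => //; last exact: (uB _ iN).
by rewrite lee_fin ltW// (split_w_gt0 spl).
Qed.

Lemma particle_lln_nonneg (f : X -> R) : measurable_fun setT f ->
  (forall x, 0 <= f x) -> (forall x, (f x ^+ 2)%:E <= V x)%E ->
  {ae P, forall u, particle_mean f n u @[n --> \oo] --> fine (\int[mu]_x (f x)%:E)%E}.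
Proof.
move=> mf f0 f2V.
have [_ _ [mV V1] IV [Rc [rho [Rc0 rho0 rho1 ergV]]]] := erg.
have V0 x : (0 <= V x)%E by exact: V_ge0.
have nV := nnmV mV V1.
have fE : (\int[mu]_x (f x)%:E = (fine (\int[mu]_x (f x)%:E))%:E)%E.
  by rewrite fineK// (f_mean_fin Rc rho mV V1 IV ergV f mf f0 f2V).
set a := fine _ in fE *.
have a0 : 0 <= a by apply: fine_ge0; apply: integral_ge0 => x _; rewrite lee_fin.
pose CV := fine (\int[mu]_x V x)%E + Rc.
have CV0 : 0 <= CV.
  by rewrite addr_ge0 ?(ltW Rc0)// fine_ge0// integral_ge0.
have KV t x : (kpow_pos K t V x <= CV%:E * V x)%E.
  exact: (kpow_V_le Rc rho Rc0 rho0 rho1 mV V1 IV ergV).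
have fa c x : 0 < c -> ((f x)%:E <= c%:E + (c^-1)%:E * V x)%E.
  exact: f_le_affine.
have Kge t x : (a%:E <= kpow_pos K t (EFin \o f) x + (Rc * rho ^+ t)%:E * V x)%E.
  by rewrite -fE; exact: kpow_f_ge.
have Kle t x b : 0 < b ->
    (kpow_pos K t (EFin \o f) x <= a%:E + b%:E + (Rc * rho ^+ t / b)%:E * V x)%E.
  by move=> b0; rewrite -fE; exact: kpow_f_le.
(* Countably many events exhausting the set where m_0(V) is finite, so the exceptional null sets can
   be collected. *)
pose A L := [set u | (m 0 V u < L%:R%:E)%E].
have sF := split_sigmaF spl 0.
have FA L : F 0 (A L).
  rewrite -(sub_sigmaE _ _ sF) -[A L]setTI.
  exact: emeasurable_fun_infty_o (nnm_split spl 0 _ nV).1 _.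
have lln L : {ae P, forall u, A L u -> particle_mean f n u @[n --> \oo] --> a}.
  apply: (lln_on spl mass1 V nV V1 a Rc rho CV a0 Rc0 rho0 rho1 CV0 KV f mf f0
            fa Kge Kle (A L) L%:R (FA L) _ _) => // u.
  exact: ltW.
have := ae_foralln lln.
apply: filterS2 initial_V_lt_pinfty => u Vu llnu.
have m0 : (0 <= m 0 V u)%E by exact: (nnm_split spl 0 _ nV).2.
apply: (llnu (Num.truncn (fine (m 0 V u))).+1).
rewrite /A /= -[ltLHS]fineK ?ge0_fin_numE//.
by rewrite lte_fin truncnS_gt.
Qed.

Lemma particle_lln (f : X -> R) : measurable_fun setT f ->
  (exists c : R, forall x, ((f x ^+ 2)%:E <= c%:E * V x)%E) ->
  exists2 a : R, (\int[mu]_x (f x)%:E)%E = a%:E &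
  {ae P, forall u, particle_mean f n u @[n --> \oo] --> a}.
Proof.
move=> mf [c fc].
have [_ _ [mV V1] IV [Rc [rho [Rc0 rho0 rho1 ergV]]]] := erg.
(* Then [c <= k ^+ 2], and [k] is positive whatever the sign of [c]; dividing by [k] brings the
   squares of both parts of [f] below V. *)
pose k := `|c| + 1.
have k0 : 0 < k by rewrite ltr_wpDl.
have ck : c <= k ^+ 2.
  by rewrite /k; have := ler_norm c; have := normr_ge0 c; nra.
pose f1 x := Num.max (f x) 0 / k.
pose f2 x := Num.max (- f x) 0 / k.
have f10 x : 0 <= f1 x by rewrite divr_ge0 ?(ltW k0)// le_max lexx orbT.
have f20 x : 0 <= f2 x by rewrite divr_ge0 ?(ltW k0)// le_max lexx orbT.
have mf1 : measurable_fun setT f1.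
  by apply: measurable_funM => //; exact: measurable_maxr.
have mf2 : measurable_fun setT f2.
  apply: measurable_funM => //; apply: measurable_maxr => //.
  exact: measurableT_comp.
have fE x : f x = k * (f1 x - f2 x).
  rewrite /f1 /f2 -mulrBl mulrC divfK ?gt_eqF//.
  have [r0|r0] := leP (f x) 0; [rewrite max_l ?oppr_ge0// sub0r opprK//|].
  by rewrite max_r ?subr0// oppr_le0 ltW.
have bound (g : X -> R) x : 0 <= g x -> g x <= `|f x| / k -> ((g x ^+ 2)%:E <= V x)%E.
  move=> g0 gf; have := fc x; have := V1 x; case: (V x) => [v||]//; last by move=> *; rewrite leey.
  rewrite -EFinM !lee_fin => v1 fv.
  have g2 : g x ^+ 2 <= (`|f x| / k) ^+ 2 by rewrite lerXn2r ?nnegrE ?g0 ?(le_trans g0 gf).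
  apply: (le_trans g2); rewrite expr_div_n real_normK ?num_real//.
  rewrite ler_pdivrMr ?exprn_gt0// mulrC (le_trans fv)// ler_wpM2r//.
  exact: le_trans v1.
have f12 x : ((f1 x ^+ 2)%:E <= V x)%E.
  apply: bound => //; rewrite ler_pM2r ?invr_gt0// ge_max normr_ge0 andbT.
  exact: ler_norm.
have f22 x : ((f2 x ^+ 2)%:E <= V x)%E.
  apply: bound => //; rewrite ler_pM2r ?invr_gt0// ge_max normr_ge0 andbT.
  by rewrite -normrN ler_norm.
have fin1 := f_mean_fin Rc rho mV V1 IV ergV f1 mf1 f10 f12.
have fin2 := f_mean_fin Rc rho mV V1 IV ergV f2 mf2 f20 f22.
have lln1 := particle_lln_nonneg f1 mf1 f10 f12.
have lln2 := particle_lln_nonneg f2 mf2 f20 f22.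
set a1 := fine _ in lln1; set a2 := fine _ in lln2.
exists (k * (a1 - a2)).
  have Z (g h : X -> R) : measurable_fun setT g -> (forall x, 0 <= g x) ->
      (forall x, h x = k * g x) ->
      (\int[mu]_x (h x)%:E = k%:E * \int[mu]_x (g x)%:E)%E.
    move=> mg g0 hE; under eq_integral do rewrite hE EFinM.
    rewrite ge0_integralZl ?lee_fin ?(ltW k0)//; first exact/measurable_EFinP.
    by move=> x _; rewrite lee_fin.
  have kf1 x : Num.max (f x) 0 = k * f1 x by rewrite mulrC divfK// gt_eqF.
  have kf2 x : Num.max (- f x) 0 = k * f2 x by rewrite mulrC divfK// gt_eqF.
  rewrite integralE.
  under eq_integral do rewrite funeposE -EFin_max kf1.
  under [X in (_ - X)%E]eq_integral do rewrite funenegE -EFinN -EFin_max kf2.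
  rewrite (Z f1 (fun x => k * f1 x))// (Z f2 (fun x => k * f2 x))//.
  by rewrite -(fineK fin1) -(fineK fin2) -!EFinM -EFinB -mulrBr.
apply: filterS2 lln1 lln2 => u h1 h2.
have -> : (fun n => particle_mean f n u) =
    (fun n => k * (particle_mean f1 n u - particle_mean f2 n u)).
  apply/funext => n; rewrite /particle_mean -mulrBr mulrCA; congr (_ * _).
  rewrite -sumrB mulr_sumr; apply: eq_bigr => t _.
  rewrite /particle_sum -sumrB mulr_sumr; apply: eq_bigr => i _.
  by rewrite -mulrBr mulrCA fE.
by apply: cvgM; [exact: cvg_cst|exact: cvgB].
Qed.

End StrongLaw.

(** The implications form a cycle. From (iii) to (i), [f = 1] is admissible with [c = 1] because
    [V >= 1], and almost sure convergence implies convergence in probability. *)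
Theorem mainTheorem2 (R : realType)
  (dO : measure_display) (Om : measurableType dO) (P : probability Om R)
  (dX : measure_display) (X : measurableType dX)
  (K : R.-pker X ~> X) (mu0 : probability X R)
  (N0 : nat) (N : nat -> Om -> nat)
  (xi : nat -> nat -> Om -> X) (w : nat -> nat -> Om -> R)
  (C : nat -> nat -> Om -> R) (M : nat -> nat -> Om -> nat)
  (xih : nat -> nat -> Om -> X) (wh : nat -> nat -> Om -> R)
  (F Fh : nat -> set (set Om))
  (mu : probability X R) (V : X -> \bar R) :
  splitting_method P K mu0 N0 N xi w C M xih wh F Fh ->
  V_uniformly_ergodic K mu V ->
  mu0 [set x | (V x < +oo)%E] = 1%E ->
  [<->
   (* (i) *)
   (forall eps : R, 0 < eps ->
      P [set om | eps < `| (T%:R)^-1 *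
                           (\sum_(t < T) \sum_(i < N t om) w t i om) - 1 |]
      @[T --> \oo] --> 0%E);
   (* (ii) *)
   P [set om | forall t, \sum_(i < N t om) w t i om = 1] = 1%E;
   (* (iii) *)
   (forall f : X -> R, measurable_fun setT f ->
      (exists c : R, forall x, ((f x ^+ 2)%:E <= c%:E * V x)%E) ->
      P [set om | ((T%:R)^-1 *
                   (\sum_(t < T) \sum_(i < N t om) w t i om * f (xi t i om)))%:E
                  @[T --> \oo] --> (\int[mu]_x (f x)%:E)%E] = 1%E)].
Proof.
move=> spl erg muV; tfae.
- move=> mean1; exact: (mass_eq1_of_mean spl mean1).
- move=> mass1 f mf fc.
  have mS : measurable [set u | forall t, mass (N := N) (w := w) t u = 1].
    rewrite (_ : [set u | _] = \bigcap_t [set u | mass (N := N) (w := w) t u = 1]); last first.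
      by apply/seteqP; split=> u /= Su; [move=> t _; exact: Su|move=> t; exact: Su].
    apply: bigcap_measurable => // t _; rewrite -[X in measurable X]setTI.
    exact: (measurable_mass spl t measurableT _ (measurable_set1 1)).
  have /(prob1_ae _ _ mS) aeS := mass1.
  have [a aE lln] := particle_lln spl erg muV aeS f mf fc.
  (* Since mu(f) is the real number [a], the limit in the extended reals is a real limit. *)
  have setE : [set om | (particle_mean (N := N) (xi := xi) (w := w) f T om)%:E
      @[T --> \oo] --> (\int[mu]_x (f x)%:E)%E] =
      [set om | particle_mean (N := N) (xi := xi) (w := w) f T om @[T --> \oo] --> a].
    apply/seteqP; split=> u /=; rewrite aE; first by move/fine_cvgP => [].
    by move=> h; apply/fine_cvgP; split => //; exact: nearW.
  rewrite -[X in P X = _]/([set om | (particle_mean (N := N) (xi := xi) (w := w) f T om)%:E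
      @[T --> \oo] --> (\int[mu]_x (f x)%:E)%E]) setE.
  apply/prob1_ae => //; apply: measurable_cvg_set => n.
  exact: (measurable_particle_mean spl).
- move=> lln eps eps0.
  have [_ _ [mV V1] IV _] := erg.
  have E1 : (\int[mu]_x (1%:E : \bar R) = 1%:E)%E.
    by rewrite integral_cst// mul1e; exact: probability_setT.
  have c1 : exists c : R, forall x, ((1 ^+ 2)%:E <= c%:E * V x)%E.
    by exists 1 => x; rewrite mul1e expr1n.
  have := lln (fun=> 1) (measurable_cst _) c1; rewrite E1.
  have setE : [set om | ((T%:R)^-1 *
      (\sum_(t < T) \sum_(i < N t om) w t i om * 1))%:E @[T --> \oo] --> (1 : R)%:E] =
      [set om | mean_mass (N := N) (w := w) T om @[T --> \oo] --> (1 : R)].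
    have eqf om : (fun T => ((T%:R)^-1 * (\sum_(t < T) \sum_(i < N t om) w t i om * 1))%:E) =
        (fun T => (mean_mass (N := N) (w := w) T om)%:E).
      apply/funext => T; rewrite /mean_mass /mass; congr ((_ * _)%:E).
      by apply: eq_bigr => t _; apply: eq_bigr => i _; rewrite mulr1.
    apply/seteqP; split=> u /=; rewrite eqf; first by move/fine_cvgP => [].
    by move=> h; apply/fine_cvgP; split => //; exact: nearW.
  rewrite setE => /(prob1_ae _ _ _) mean1.
  apply: (ae_cvg_in_probability (mean_mass (N := N) (w := w)) 1 eps _ _ eps0).
    by move=> n; exact: (measurable_mean_mass spl).
  apply: mean1; apply: measurable_cvg_set => n.
  exact: (measurable_mean_mass spl).
Qed.
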